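(* Let $X\in\mathbb{R}^{n\times d}$ be fixed with rows $x_1,\dots,x_n$, $\hat\Sigma=\frac1nX^\top X$, and let $Y_1,\dots,Y_n$ be independent with $Y_i\sim P_i$, $\mu_i=\mathbb{E}[Y_i]$, $\mu=(\mu_1,\dots,\mu_n)$. Let $f(\theta)=\frac1n\big(-Y^\top X\theta+\sum_{i=1}^nA(x_i^\top\theta)\big)$, and consider the following cases: Case 1, Gaussian (linear regression): $P_i=\mathcal{N}(\mu_i,\sigma_i^2)$, $A(u)=u^2/2$, and $\sigma=\max_{i}\sigma_i$. Case 2, Bernoulli (logistic regression): $P_i=\mathrm{Bern}(\mu_i)$, $A(u)=\log(1+e^u)$, and $\sigma=\frac12$. Case 3, Poisson (Poisson regression): $P_i=\mathrm{Pois}(\mu_i)$, $A(u)=e^u$, and $\sigma=(6\|\mu\|_\infty+2)\log n+3\sqrt{\|\mu\|_\infty}$. In cases 1 and 2, $f$ is $L$-smooth on $\mathbb{R}^d$ with $L=\|\hat\Sigma\|_{\mathrm{op}}$ and $L=\frac14\|\hat\Sigma\|_{\mathrm{op}}$, respectively; in case 3, $f$ is $L$-smooth on $\mathsf{B}_d(b)=\{x\in\mathbb{R}^d:\|x\|_2\le b\}$ with $L=\exp(b\cdot\max_{i}\|x_i\|_2)\cdot\|\hat\Sigma\|_{\mathrm{op}}$, for any $b>0$. Fix any $\delta>0$ and $b>0$. Consider gradient descent $\theta_{t+1}=\theta_t-\eta\nabla f(\theta_t)$ in cases 1 and 2, and projected gradient descent $\theta_{t+1}=\Pi_{\mathsf{B}_d(b)}(\theta_t-\eta\nabla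 f(\theta_t))$ in case 3, in each case with constant step size $\eta\in(0,1/L]$ and initialization $\theta_0=0$. Let $$\lambda_T^*=\frac{\sigma}{b\sqrt n}\sqrt{\mathrm{tr}(\hat\Sigma)+2\sqrt\delta\|\hat\Sigma\|_F+2\delta\|\hat\Sigma\|_{\mathrm{op}}},\qquad T^*=\frac{1}{\eta\lambda_T^*}.$$ The following holds. (a) If $T^*$ is an integer, then for $T=T^*$ the bound $$\mathrm{Risk}(\theta_T)-\min_{\theta:\|\theta\|_2\le b}\mathrm{Risk}(\theta)\le\frac{b\sigma}{\sqrt n}\sqrt{\mathrm{tr}(\hat\Sigma)+2\sqrt\delta\|\hat\Sigma\|_F+2\delta\|\hat\Sigma\|_{\mathrm{op}}}$$ holds with probability at least $1-e^{-\delta}$ in cases 1 and 2, and at least $1-e^{-\delta}-1/n$ in case 3 provided that $\delta\ge1$ and $n\ge3$. (b) If $T^*$ is not an integer, then for $T=\lceil T^*\rceil$ the bound in (a) holds (with the same probabilities and provisos) with the additional additive term $e_T=\frac{\eta\sigma^2}{2n}\big(\mathrm{tr}(\hat\Sigma)+2\sqrt\delta\|\hat\Sigma\|_F+2\delta\|\hat\Sigma\|_{\mathrm{op}}\big)$ on the right-hand side.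
   Context: $Y=(Y_1,\dots,Y_n)$. The prediction risk of an estimator $\hat\theta=\hat\theta(X,Y)$ is $\mathrm{Risk}(\hat\theta)=\frac1n\mathbb{E}\big[-(Y^* )^\top X\hat\theta+\sum_{i=1}^nA(x_i^\top\hat\theta)\,\big|\,Y\big]=\frac1n\big(-\mu^\top X\hat\theta+\sum_{i=1}^nA(x_i^\top\hat\theta)\big)$, where $Y^*$ is an independent copy of $Y$ (each $Y_i^*\sim P_i$). No model for $\mu_i$ in terms of $x_i$ is assumed. $\Pi_S$ is Euclidean projection onto $S$; $\|\cdot\|_F$ and $\|\cdot\|_{\mathrm{op}}$ are Frobenius and operator norms. $f$ is $L$-smooth on a set if $\|\nabla f(x)-\nabla f(y)\|_2\le L\|x-y\|_2$ for $x,y$ in the set. *)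

(* Defs.v *)
(* MathComp-Analysis, over an abstract [R : realType]. *)
From HB Require Import structures.
From mathcomp Require Import all_boot all_order all_algebra.
From mathcomp Require Import all_classical all_reals all_analysis.

Set Implicit Arguments.
Unset Strict Implicit.
Unset Printing Implicit Defensive.

Import Order.TTheory GRing.Theory Num.Theory.
Import numFieldNormedType.Exports.

Local Open Scope classical_set_scope.
Local Open Scope ring_scope.

Section euclidean.
Context {R : realType}.

(* The canonical norm [`|v|] on matrices is the sup norm, hence this one. *)
Definition norm2 k (v : 'cV[R]_k) : R := Num.sqrt (\sum_i v i 0 ^+ 2).

Definition ball2 k (b : R) : set 'cV[R]_k := [set v | norm2 v <= b].

Definition frobenius k l (M : 'M[R]_(k, l)) : R :=
  Num.sqrt (\sum_i \sum_j M i j ^+ 2).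

Definition opnorm k l (M : 'M[R]_(k, l)) : R :=
  sup [set norm2 (M *m v) | v in ball2 (k := l) 1].

(* A minimizer of [g] over [S]; the junk value 0 is returned only if the
   minimum is not attained. *)
Definition argmin k (S : set 'cV[R]_k) (g : 'cV[R]_k -> R) : 'cV[R]_k :=
  xget 0 [set u | S u /\ forall v, S v -> g u <= g v].

Definition min_over k (S : set 'cV[R]_k) (g : 'cV[R]_k -> R) : R :=
  g (argmin S g).

Definition proj k (S : set 'cV[R]_k) (u : 'cV[R]_k) : 'cV[R]_k :=
  argmin S (fun v => norm2 (u - v)).

Definition grad k (f : 'cV[R]_k -> R) (u : 'cV[R]_k) : 'cV[R]_k :=
  \col_j 'D_(delta_mx j 0) f u.

Definition L_smooth k (S : set 'cV[R]_k) (f : 'cV[R]_k -> R) (L : R) : Prop :=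
  (forall u, S u -> differentiable f u) /\
  (forall u v, S u -> S v -> norm2 (grad f u - grad f v) <= L * norm2 (u - v)).

End euclidean.

Definition mutually_independent d (T : measurableType d) (R : realType)
    (P : probability T R) (I : finType) (Y : I -> {RV P >-> R}) : Prop :=
  forall (J : {set I}) (B : I -> set R), (forall i, measurable (B i)) ->
    P (\bigcap_(i in [set` J]) (Y i @^-1` B i)) =
    (\prod_(i in J) P (Y i @^-1` B i))%E.

(* [Gaussian s]: linear regression, [s i] being the standard deviation of the
   i-th response; [Bernoulli]: logistic regression; [Poisson]: Poisson
   regression. *)
Inductive model (R : realType) (n : nat) : Type :=
| Gaussian of ('I_n -> R)
| Bernoulli
| Poisson.
Arguments Bernoulli {R n}.
Arguments Poisson {R n}.

Section model.
Context {R : realType} {n : nat}.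
Implicit Types (c : model R n).

(* [normal_prob m 0] is not a point mass, so the degenerate Gaussian law is
   treated separately. *)
Definition gaussian_law (m s : R) : set R -> \bar R :=
  if s == 0 then \d_m else normal_prob m s.

(* The law P_i with mean [m].  Outside the parameter ranges ([0 <= m <= 1],
   resp. [0 <= m]), [bernoulli_prob m] and [poisson_prob m _] are point masses
   at 0, whose mean is not [m].  The second argument of [poisson_prob] is
   unused. *)
Definition law c (i : 'I_n) (m : R) : set R -> \bar R :=
  match c with
  | Gaussian s => gaussian_law m (s i)
  | Bernoulli => pushforward (bernoulli_prob m) (fun y : bool => y%:R : R)
  | Poisson => pushforward (poisson_prob m 0) (fun k : nat => k%:R : R)
  end.

Definition sd_ge0 c : Prop :=
  match c with Gaussian s => forall i, 0 <= s i | _ => True end.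

Definition cumulant c (u : R) : R :=
  match c with
  | Gaussian _ => u ^+ 2 / 2
  | Bernoulli => ln (1 + expR u)
  | Poisson => expR u
  end.

(* [`|mu|] is the sup norm of the vector [mu]. *)
Definition noise_level c (mu : 'cV[R]_n) : R :=
  match c with
  | Gaussian s => \big[Num.max/0]_(i < n) s i
  | Bernoulli => 2^-1
  | Poisson => (6 * `|mu| + 2) * ln n%:R + 3 * Num.sqrt `|mu|
  end.

Section design.
Context {d : nat} (X : 'M[R]_(n, d)).

Definition Sigma_hat : 'M[R]_d := n%:R^-1 *: (X^T *m X).

Definition objective c (y : 'cV[R]_n) (theta : 'cV[R]_d) : R :=
  n%:R^-1 * (- (y^T *m X *m theta) 0 0
             + \sum_(i < n) cumulant c ((X *m theta) i 0)).

Definition smooth_domain c (b : R) : set 'cV[R]_d :=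
  match c with Poisson => ball2 b | _ => setT end.

Definition smooth_const c (b : R) : R :=
  match c with
  | Gaussian _ => opnorm Sigma_hat
  | Bernoulli => 4^-1 * opnorm Sigma_hat
  | Poisson => expR (b * \big[Num.max/0]_(i < n) norm2 (row i X)^T)
               * opnorm Sigma_hat
  end.

Definition gd_step c (b eta : R) (y : 'cV[R]_n) (theta : 'cV[R]_d) : 'cV[R]_d :=
  let theta' := theta - eta *: grad (objective c y) theta in
  match c with Poisson => proj (ball2 b) theta' | _ => theta' end.

Definition gd c (b eta : R) (y : 'cV[R]_n) (t : nat) : 'cV[R]_d :=
  iter t (gd_step c b eta y) 0.

(* tr(Sigma) + 2 sqrt(delta) |Sigma|_F + 2 delta |Sigma|_op *)
Definition complexity (delta : R) : R :=
  \tr Sigma_hat + 2 * Num.sqrt delta * frobenius Sigma_hat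
  + 2 * delta * opnorm Sigma_hat.

Definition lambda_star c (mu : 'cV[R]_n) (delta b : R) : R :=
  noise_level c mu / (b * Num.sqrt n%:R) * Num.sqrt (complexity delta).

Definition T_star c (mu : 'cV[R]_n) (delta b eta : R) : R :=
  (eta * lambda_star c mu delta b)^-1.

Definition risk_bound c (mu : 'cV[R]_n) (delta b : R) : R :=
  b * noise_level c mu / Num.sqrt n%:R * Num.sqrt (complexity delta).

Definition rounding_term c (mu : 'cV[R]_n) (delta eta : R) : R :=
  eta * noise_level c mu ^+ 2 / (2 * n%:R) * complexity delta.

Definition responses dO (O : measurableType dO) (P : probability O R)
    (Y : 'I_n -> {RV P >-> R}) (w : O) : 'cV[R]_n := \col_i Y i w.

(* Y* being an independent copy of Y, conditioning on Y in
   E[- (Y* )^T X theta_hat + sum_i A(x_i^T theta_hat) | Y] amounts to fixing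
   theta = theta_hat(X, Y) and integrating over a fresh copy of Y. *)
Definition risk c dO (O : measurableType dO) (P : probability O R)
    (Y : 'I_n -> {RV P >-> R}) (theta : 'cV[R]_d) : R :=
  fine 'E_P[fun w => objective c (responses Y w) theta].

End design.

Definition provisos c (delta : R) : Prop :=
  match c with Poisson => 1 <= delta /\ (3 <= n)%N | _ => True end.

Definition confidence c (delta : R) : R :=
  match c with
  | Poisson => 1 - expR (- delta) - n%:R^-1
  | _ => 1 - expR (- delta)
  end.

End model.

(* Main.v *)
Require Import Defs.
From mathcomp Require Import all_boot all_order all_algebra.
From mathcomp Require Import all_classical all_reals all_analysis.
From mathcomp Require Import measurable_realfun.
From mathcomp Require Import ring lra complex spectral sesquilinear.

(** The objective [f] that gradient descent sees and the risk differ by a linear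
function: risk = f + <v, .> with v = X^T (Y - mu) / n.  Since [f] is convex and
L-smooth and eta <= 1/L, the iterates satisfy, for every u in the ball,
  f(theta_T) - f(u) <= (|u|^2 - |theta_T - u|^2) / (2 eta T).
Adding <v, theta_T - u> and absorbing it in the negative term gives
  risk(theta_T) - risk(u) <= b^2 / (2 eta T) + eta T |v|^2 / 2
([descent_tilted], [gd_excess]).  On the event |v| <= b lambda the choice
eta T = 1 / lambda balances the two terms, and rounding T up costs at most
eta (b lambda)^2 / 2 ([balanced_rate]).

It remains to bound |v|^2, a quadratic form in the centred responses, which are
independent and sub-Gaussian.  An orthogonal change of basis diagonalises Sigma
([symmetric_diagonalizable]) and writes |v|^2 as a sum of squares
<r_j, Y - mu>^2 with orthogonal r_j ([gram_rotation]).  Each square is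
linearised by exp(u^2 / 2) = E exp(g u) with g standard Gaussian; exchanging the
expectations leaves linear exponents, to which sub-Gaussianity applies, and
Gaussian integrals with the product prod_j (1 - x_j)^(-1/2) as value
([quadratic_mgf]).  Chernoff's bound with the optimal exponent then yields
exactly tr + 2 sqrt(delta) |.|_F + 2 delta |.|_op ([quadratic_tail]).

Sub-Gaussianity is a computation for Gaussian responses and Hoeffding's bound
for Bernoulli responses.  A Poisson response is not sub-Gaussian, but its moment
generating function restricted to {Y_i <= mu_i + (6 |mu| + 2) ln n} is
([poisson_truncated_mgf]), and all the responses satisfy this restriction except
with probability 1/n, by a union bound ([responses_subgaussian]). *)

Set Implicit Arguments.
Unset Strict Implicit.
Unset Printing Implicit Defensive.

Import Order.TTheory GRing.Theory Num.Theory.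
Import numFieldNormedType.Exports.

Local Open Scope classical_set_scope.
Local Open Scope ring_scope.

(** * Euclidean geometry of column vectors *)

Section dot.
Context {R : realType}.

Definition dot k (u v : 'cV[R]_k) : R := \sum_i u i 0 * v i 0.

Lemma dotC k (u v : 'cV[R]_k) : dot u v = dot v u.
Proof. by apply: eq_bigr => i _; rewrite mulrC. Qed.

Lemma dotDl k (u v w : 'cV[R]_k) : dot (u + v) w = dot u w + dot v w.
Proof. by rewrite -big_split; apply: eq_bigr => i _; rewrite mxE mulrDl. Qed.

Lemma dotZl k a (u v : 'cV[R]_k) : dot (a *: u) v = a * dot u v.
Proof. by rewrite mulr_sumr; apply: eq_bigr => i _; rewrite mxE mulrA. Qed.

Lemma dotNl k (u v : 'cV[R]_k) : dot (- u) v = - dot u v.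
Proof. by rewrite -scaleN1r dotZl mulN1r. Qed.

Lemma dotDr k (u v w : 'cV[R]_k) : dot w (u + v) = dot w u + dot w v.
Proof. by rewrite dotC dotDl !(dotC w). Qed.

Lemma dotZr k a (u v : 'cV[R]_k) : dot v (a *: u) = a * dot v u.
Proof. by rewrite dotC dotZl dotC. Qed.

Lemma dotNr k (u v : 'cV[R]_k) : dot v (- u) = - dot v u.
Proof. by rewrite dotC dotNl dotC. Qed.

Lemma dot0l k (v : 'cV[R]_k) : dot 0 v = 0.
Proof. by rewrite -(scale0r 0) dotZl mul0r. Qed.

Definition dotE := (dotDl, dotDr, dotNl, dotNr, dotZl, dotZr).

Lemma dot_mx k (u v : 'cV[R]_k) : (u^T *m v) 0 0 = dot u v.
Proof. by rewrite mxE; apply: eq_bigr => i _; rewrite mxE. Qed.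

Lemma dot_mulmx k l (M : 'M[R]_(k, l)) u v : dot (M *m u) v = dot u (M^T *m v).
Proof. by rewrite -!dot_mx trmx_mul mulmxA. Qed.

Lemma dot_ge0 k (u : 'cV[R]_k) : 0 <= dot u u.
Proof. by apply: sumr_ge0 => i _; rewrite -expr2 sqr_ge0. Qed.

Lemma norm2E k (u : 'cV[R]_k) : norm2 u = Num.sqrt (dot u u).
Proof. by congr Num.sqrt; apply: eq_bigr => i _; rewrite expr2. Qed.

Lemma sqr_norm2 k (u : 'cV[R]_k) : norm2 u ^+ 2 = dot u u.
Proof. by rewrite norm2E sqr_sqrtr// dot_ge0. Qed.

Lemma norm2_ge0 k (u : 'cV[R]_k) : 0 <= norm2 u.
Proof. exact: sqrtr_ge0. Qed.
#[local] Hint Resolve norm2_ge0 : core.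

Lemma norm2_le k (u : 'cV[R]_k) a : 0 <= a -> (norm2 u <= a) = (dot u u <= a ^+ 2).
Proof. by move=> a0; rewrite -sqr_norm2 ler_pXn2r ?nnegrE. Qed.

Lemma norm2Z k a (u : 'cV[R]_k) : norm2 (a *: u) = `|a| * norm2 u.
Proof.
by rewrite !norm2E !dotE mulrA -expr2 sqrtrM ?sqr_ge0// sqrtr_sqr.
Qed.

Lemma dot_eq0 k (u : 'cV[R]_k) : (dot u u == 0) = (u == 0).
Proof.
apply/eqP/eqP => [|->]; last by rewrite dot0l.
move=> /eqP; rewrite psumr_eq0 => [|i _]; last by rewrite -expr2 sqr_ge0.
move=> /allP h.
apply/colP => i; rewrite mxE; apply/eqP.
by have := h i (mem_index_enum _); rewrite /= -expr2 sqrf_eq0.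
Qed.

Lemma cauchy_schwarz k (u v : 'cV[R]_k) : dot u v <= norm2 u * norm2 v.
Proof.
have [->|u0] := eqVneq u 0; first by rewrite dot0l mulr_ge0.
have uu : 0 < dot u u by rewrite lt_neqAle eq_sym dot_eq0 u0 dot_ge0.
have := dot_ge0 (dot u u *: v - dot u v *: u).
rewrite !dotE (dotC v u).
set a := dot u u; set b := dot u v; set c := dot v v => h.
have : 0 <= a * (a * c - b ^+ 2) by nra.
rewrite pmulr_rge0// subr_ge0 => bac.
rewrite (le_trans (ler_norm _))//.
rewrite -(@ler_pXn2r _ 2)// ?nnegrE ?mulr_ge0//.
by rewrite exprMn !sqr_norm2 real_normK ?num_real.
Qed.

End dot.
#[global] Hint Extern 0 (is_true (0 <= norm2 _)) => exact: norm2_ge0 : core.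

Section opnorm.
Context {R : realType}.

Lemma norm2_mulmx_frobenius k l (M : 'M[R]_(k, l)) v :
  norm2 (M *m v) <= frobenius M * norm2 v.
Proof.
have F0 : 0 <= \sum_i \sum_j M i j ^+ 2.
  by apply: sumr_ge0 => i _; apply: sumr_ge0 => j _; rewrite sqr_ge0.
rewrite norm2_le ?mulr_ge0 ?sqrtr_ge0// exprMn sqr_sqrtr// sqr_norm2 mulr_suml.
apply: ler_sum => i _.
have -> : (M *m v) i 0 = dot (row i M)^T v.
  by rewrite mxE; apply: eq_bigr => j _; rewrite !mxE.
rewrite -expr2 -(@real_normK _ (dot _ _)) ?num_real//.
have -> : (\sum_j M i j ^+ 2) * dot v v = (norm2 (row i M)^T * norm2 v) ^+ 2.
  rewrite exprMn !sqr_norm2; congr (_ * _); apply: eq_bigr => j _.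
  by rewrite !mxE expr2.
rewrite ler_pXn2r ?nnegrE ?normr_ge0 ?mulr_ge0//.
rewrite ler_norml cauchy_schwarz andbT.
rewrite lerNl -dotNl (le_trans (cauchy_schwarz _ _))//.
by rewrite -scaleN1r norm2Z normrN1 mul1r.
Qed.

Lemma opnorm_has_sup k l (M : 'M[R]_(k, l)) :
  has_sup [set norm2 (M *m v) | v in ball2 (k := l) 1].
Proof.
split.
  exists (norm2 (M *m 0)), 0 => //=.
  by rewrite /ball2/= norm2_le// dot0l expr1n.
exists (frobenius M) => _ [v v1 <-].
rewrite (le_trans (norm2_mulmx_frobenius _ _))// ler_piMr ?sqrtr_ge0//.
Qed.

Lemma norm2_mulmx_opnorm k l (M : 'M[R]_(k, l)) v :
  norm2 (M *m v) <= opnorm M * norm2 v.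
Proof.
have [->|v0] := eqVneq v 0.
  by rewrite mulmx0 !norm2E !dot0l sqrtr0 mulr0.
have nv : 0 < norm2 v by rewrite norm2E sqrtr_gt0 lt_neqAle eq_sym dot_eq0 v0 dot_ge0.
rewrite -ler_pdivrMr// mulrC.
have -> : (norm2 v)^-1 * norm2 (M *m v) = norm2 (M *m ((norm2 v)^-1 *: v)).
  by rewrite -scalemxAr norm2Z ger0_norm ?invr_ge0.
apply: sup_upper_bound; first exact: opnorm_has_sup.
exists ((norm2 v)^-1 *: v) => //.
by rewrite /ball2/= norm2Z ger0_norm ?invr_ge0// mulVf ?gt_eqF.
Qed.

Lemma opnorm_ge0 k l (M : 'M[R]_(k, l)) : 0 <= opnorm M.
Proof.
apply: (@le_trans _ _ (norm2 (M *m 0))) => //.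
apply: sup_upper_bound; first exact: opnorm_has_sup.
by exists 0 => //; rewrite /ball2/= norm2_le// dot0l expr1n.
Qed.

(** The quadratic form of a Gram matrix is a squared norm, so its operator norm
controls the design itself. *)
Lemma gram_dot k l (X : 'M[R]_(k, l)) h : dot (X *m h) (X *m h) <= opnorm (X^T *m X) * dot h h.
Proof.
rewrite dot_mulmx mulmxA (le_trans (cauchy_schwarz _ _))//.
by rewrite -sqr_norm2 expr2 mulrA mulrC ler_wpM2r// norm2_mulmx_opnorm.
Qed.

(** A matrix and its transpose have the same norm: |X^T z|^2 = <z, X X^T z> is
at most |z| sqrt(|X^T X|) |X^T z|. *)
Lemma gram_dot_tr k l (X : 'M[R]_(k, l)) z : dot (X^T *m z) (X^T *m z) <= opnorm (X^T *m X) * dot z z.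
Proof.
set w := X^T *m z; set L := opnorm _.
have L0 : 0 <= L by exact: opnorm_ge0.
have [w0|w0] := eqVneq w 0; first by rewrite w0 dot0l mulr_ge0// dot_ge0.
have ww : 0 < dot w w by rewrite lt_neqAle eq_sym dot_eq0 w0 dot_ge0.
have : dot w w <= norm2 z * norm2 (X *m w).
  by rewrite {1}/w dot_mulmx trmxK cauchy_schwarz.
rewrite -(@ler_pXn2r _ 2)// ?nnegrE ?mulr_ge0 ?dot_ge0// exprMn !sqr_norm2 => h.
have h2 : dot w w ^+ 2 <= dot z z * (L * dot w w).
  by rewrite (le_trans h)// ler_wpM2l ?dot_ge0// gram_dot.
have : dot w w * dot w w <= L * dot z z * dot w w.
  by rewrite -expr2 (le_trans h2)// mulrCA mulrA.
by rewrite ler_pM2r.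
Qed.

End opnorm.

(** * Projection onto a Euclidean ball *)

Section ball_projection.
Context {R : realType} {k : nat} (b : R).
Hypothesis b_gt0 : 0 < b.
Implicit Types u v : 'cV[R]_k.

Definition clip u : 'cV[R]_k :=
  if norm2 u <= b then u else (b / norm2 u) *: u.

Lemma clip_ball u : ball2 b (clip u).
Proof.
rewrite /ball2/= /clip; case: ifPn => //; rewrite -ltNge => ub.
have u0 : 0 < norm2 u := lt_trans b_gt0 ub.
by rewrite norm2Z ger0_norm ?divfK ?gt_eqF ?divr_ge0// ltW.
Qed.

Lemma clip_obtuse u v : ball2 b v -> dot (u - clip u) (v - clip u) <= 0.
Proof.
rewrite /ball2/= /clip => vb; case: ifPn => [|]; first by rewrite subrr dot0l.
rewrite -ltNge => ub; have u0 : 0 < norm2 u := lt_trans b_gt0 ub.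
rewrite !dotE -sqr_norm2; set N := norm2 u in ub u0 *.
rewrite [leLHS](_ : _ = (1 - b / N) * (dot u v - b * N)); last first.
  by field; rewrite gt_eqF.
apply: mulr_ge0_le0; first by rewrite subr_ge0 ler_pdivrMr// mul1r ltW.
by rewrite subr_le0 (le_trans (cauchy_schwarz _ _))// mulrC ler_wpM2r.
Qed.

(** The obtuse-angle inequality makes [clip u] the only closest point, hence the
one that [proj] selects. *)
Lemma proj_ball2 u : Defs.proj (ball2 b) u = clip u.
Proof.
have pyth v : ball2 b v ->
    dot (u - clip u) (u - clip u) + dot (v - clip u) (v - clip u)
    <= dot (u - v) (u - v).
  move=> /(@clip_obtuse u _); rewrite !dotE (dotC v u) (dotC v) (dotC u (clip u)).
  by move=> ?; lra.
rewrite /Defs.proj /argmin.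
have closest : [set p | ball2 b p /\
    forall v, ball2 b v -> norm2 (u - p) <= norm2 (u - v)] (clip u).
  split=> [|v /pyth h]; first exact: clip_ball.
  rewrite norm2_le// sqr_norm2 (le_trans _ h)// lerDl dot_ge0//.
have [pb pmin] := xgetPex 0 (ex_intro _ _ closest).
set p := xget _ _ in pb pmin *.
have := pmin _ (clip_ball u); rewrite norm2_le// sqr_norm2 => h.
apply/eqP; rewrite -subr_eq0 -dot_eq0 eq_le dot_ge0 andbT.
by have := pyth _ pb; lra.
Qed.

End ball_projection.

(** * Projected gradient descent on a smooth convex function *)

Section descent.
Context {R : realType} {d : nat} (f : 'cV[R]_d -> R) (G step : 'cV[R]_d -> 'cV[R]_d).
Variables (S : set 'cV[R]_d) (L eta : R).
Hypothesis eta_gt0 : 0 < eta.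
Hypothesis eta_le : eta * L <= 1.
Hypothesis f_convex : forall x y, S x -> S y -> f x + dot (G x) (y - x) <= f y.
Hypothesis f_smooth : forall x y, S x -> S y ->
  f y <= f x + dot (G x) (y - x) + L / 2 * dot (y - x) (y - x).
Hypothesis step_in : forall x, S x -> S (step x).
Hypothesis step_obtuse : forall x u, S x -> S u ->
  dot (x - eta *: G x - step x) (u - step x) <= 0.

(** The descent inequality, convexity and the obtuse angle of the step combine
into 2 eta (f(x') - f(u)) <= |x - u|^2 - |x' - u|^2, the remaining terms being
(eta L - 1) |x' - x|^2 <= 0. *)
Lemma descent_step x u : S x -> S u ->
  2 * eta * (f (step x) - f u)
  <= dot (x - u) (x - u) - dot (step x - u) (step x - u).
Proof.
move=> Sx Su; have Sy := step_in Sx.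
have := f_smooth Sx Sy; have := f_convex Sx Su; have := step_obtuse Sx Su.
set y := step x.
rewrite !dotE (dotC u x) (dotC y x) (dotC u y).
set gy := dot (G x) y; set gu := dot (G x) u; set gx := dot (G x) x.
set xx := dot x x; set yy := dot y y; set xy := dot x y.
move=> h1 h2 h3.
have yx0 : 0 <= xx - 2 * xy + yy.
  by have := dot_ge0 (x - y); rewrite !dotE (dotC y x) -/xy -/xx -/yy; lra.
have : eta * L * (xx - 2 * xy + yy) <= xx - 2 * xy + yy by rewrite ler_piMl.
move=> h4.
have : eta * f y <= eta * (f u - (gu - gx) + (gy - gx)) + eta * L / 2 * (xx - 2 * xy + yy).
  have -> : eta * (f u - (gu - gx) + (gy - gx)) + eta * L / 2 * (xx - 2 * xy + yy)
     = eta * (f u - (gu - gx) + (gy - gx) + L / 2 * (xx - 2 * xy + yy)) by ring.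
  by rewrite ler_pM2l//; lra.
by move=> h5; lra.
Qed.

(** Taking [u := x] shows that the objective decreases along the iterates, so the
last iterate is at least as good as their average and the telescoped sum bounds
it. *)
Lemma descent_iter T u : S 0 -> S u ->
  2 * eta * T%:R * (f (iter T step 0) - f u)
  <= dot u u - dot (iter T step 0 - u) (iter T step 0 - u).
Proof.
move=> S0 Su; have SI t : S (iter t step 0) by elim: t => //= t; exact: step_in.
elim: T => [|T IH].
  by rewrite mulr0 mul0r /= !sub0r !dotE opprK subrr.
have := descent_step (SI T) Su; have := descent_step (SI T) (SI T).
rewrite iterS; set x := iter T step 0 in IH *; set y := step x.
rewrite subrr dot0l sub0r => h1 h2.
have {}h1 : 2 * eta * (f y - f x) <= 0.
  by rewrite (le_trans h1)// oppr_le0 dot_ge0.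
have h3 : 2 * eta * T%:R * (f y - f u) <= 2 * eta * T%:R * (f x - f u).
  have : T%:R * (2 * eta * (f y - f x)) <= 0 by rewrite mulr_ge0_le0.
  by lra.
rewrite -natr1; lra.
Qed.

(** Descent run on [f] while the target is the tilted function [f + <v, .>]: the
negative term -|x_T - u|^2 left by the telescoping absorbs the tilt, by
2 t <v, w> <= t^2 |v|^2 + |w|^2. *)
Lemma descent_tilted T u v (x := iter T step 0) : S 0 -> S u ->
  2 * eta * T%:R * (f x + dot v x - (f u + dot v u))
  <= dot u u + (eta * T%:R) ^+ 2 * dot v v.
Proof.
move=> S0 Su; have := descent_iter T S0 Su; rewrite -/x.
have := dot_ge0 ((eta * T%:R) *: v - (x - u)).
rewrite !dotE (dotC x v) (dotC u v) (dotC u x) => h1 h2.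
by rewrite expr2; lra.
Qed.

End descent.

(** * Cumulant functions and the gradient of the objective *)

(** The derivative A' of the cumulant. *)
Definition mean_fun (R : realType) n (c : model R n) (u : R) : R :=
  match c with
  | Gaussian _ => u
  | Bernoulli => expR u / (1 + expR u)
  | Poisson => expR u
  end.

Definition curvature (R : realType) n (c : model R n) (m : R) : R :=
  match c with
  | Gaussian _ => 1
  | Bernoulli => 4^-1
  | Poisson => expR m
  end.

(** The linear predictors for which [curvature c m] bounds A''; only the
exponential has unbounded curvature. *)
Definition lin_range (R : realType) n (c : model R n) (m : R) : set R :=
  match c with Poisson => [set u | u <= m] | _ => setT end.

Section cumulant.
Context {R : realType} {n : nat}.
Implicit Types (c : model R n) (m : R).

Lemma is_derive_cumulant c (u : R) : is_derive u 1 (cumulant c) (mean_fun c u).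
Proof.
case: c => [s||] /=; last exact: is_derive_expR.
  rewrite (_ : cumulant _ = 2^-1 *: (id ^+ 2 : R -> R)); last first.
    by apply/funext => x /=; rewrite -[RHS]/(2^-1 * x ^+ 2) mulrC.
  by apply: is_derive_eq; rewrite -[LHS]/(2^-1 * (2 * u ^+ 1 * 1)); field.
have u0 : 0 < 1 + expR u by rewrite ltr_pwDr// expR_gt0.
have e : is_derive u 1 (cst 1 + @expR R) (0 + expR u) by apply: is_derive_eq.
have := @is_derive1_comp R (@ln R) (cst 1 + @expR R) u _ _
  (is_derive1_ln (u0 : 0 < (cst 1 + @expR R) u)) e.
move=> /is_derive_eq; apply.
by rewrite add0r mulrC.
Qed.

Lemma mean_fun_ndecr c (u v : R) : u <= v -> mean_fun c u <= mean_fun c v.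
Proof.
case: c => [s||] //= uv; last by rewrite ler_expR.
have pos (x : R) : 0 < 1 + expR x by rewrite ltr_pwDr// expR_gt0.
rewrite ler_pdivrMr// mulrAC ler_pdivlMr//.
by rewrite !mulrDr !mulr1 (mulrC (expR v) (expR u)) lerD2r ler_expR.
Qed.

(** For the logistic function s, s' = s(1 - s) <= 1/4; for the exponential,
e^v - e^u <= e^v (v - u) by convexity. *)
Lemma mean_fun_lip c m (u v : R) : lin_range c m v -> u <= v ->
  mean_fun c v - mean_fun c u <= curvature c m * (v - u).
Proof.
case: c => [s||] /= vm uv; first by rewrite mul1r.
- have pos (x : R) : 0 < 1 + expR x by rewrite ltr_pwDr// expR_gt0.
  pose D (x : R) := - ((1 + expR x) ^- 2) * expR x.
  have sgD (x : R) : is_derive x 1 (fun x : R => (1 + expR x)^-1) (D x).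
    have e : is_derive x 1 (cst 1 + @expR R) (0 + expR x) by apply: is_derive_eq.
    have x0 : (cst 1 + @expR R) x != 0 := lt0r_neq0 (pos x).
    apply: (is_derive_eq (is_deriveV x0 e)).
    by rewrite add0r.
  have [|c _ hc] := @MVT_segment R _ _ _ _ uv (fun x _ => sgD x).
    apply: continuous_subspaceT => x.
    by apply/differentiable_continuous/derivable1_diffP; exact: ex_derive.
  have sE x : expR x / (1 + expR x) = 1 - (1 + expR x)^-1.
    by field; rewrite gt_eqF.
  rewrite !sE opprD addrACA subrr add0r opprK addrC -opprB hc -mulNr.
  rewrite ler_wpM2r ?subr_ge0// /D mulNr opprK mulrC ler_pdivrMr ?exprn_gt0//.
  by have := sqr_ge0 (1 - expR c); lra.
- rewrite (@le_trans _ _ (expR v * (v - u)))// ?ler_wpM2r ?subr_ge0 ?ler_expR//.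
  have := expR_ge1Dx (u - v); rewrite expRB => h.
  have : expR v * (1 + (u - v)) <= expR v * (expR u / expR v).
    by rewrite ler_pM2l ?expR_gt0.
  by rewrite mulrCA divff ?gt_eqF ?expR_gt0// mulr1; lra.
Qed.

(** Applied to the cumulant A, this is convexity; applied to K x^2 / 2 - A, whose
derivative is nondecreasing when A'' <= K, it is the quadratic upper bound. *)
Lemma tangent_below (h h' : R -> R) (D : set R) (u v : R) :
  (forall x : R, is_derive x 1 h (h' x)) ->
  (forall x y, x <= y -> D y -> h' x <= h' y) ->
  (forall x y, x <= y -> D y -> D x) ->
  D u -> D v -> h u + h' u * (v - u) <= h v.
Proof.
move=> hD h'mono Ddown Du Dv.
have cont (x y : R) : {within `[x, y], continuous h}.
  apply: continuous_subspaceT => z.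
  by apply/differentiable_continuous/derivable1_diffP; exact: ex_derive.
have [uv|/ltW vu] := leP u v.
- have [c cuv hc] := MVT_segment uv (fun x _ => hD x) (cont _ _).
  rewrite addrC -lerBrDr hc ler_wpM2r ?subr_ge0//.
  move: cuv; rewrite in_itv/= => /andP[uc cv].
  by apply: h'mono => //; exact: Ddown Dv.
- have [c cuv hc] := MVT_segment vu (fun x _ => hD x) (cont _ _).
  move: cuv; rewrite in_itv/= => /andP[vc cu].
  have : h' c * (u - v) <= h' u * (u - v).
    by rewrite ler_wpM2r ?subr_ge0// h'mono.
  by rewrite -hc; lra.
Qed.

Lemma lin_range_down c m (x y : R) : x <= y -> lin_range c m y -> lin_range c m x.
Proof. by case: c => //= xy; exact: le_trans. Qed.

Lemma cumulant_tangent c (u v : R) :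
  cumulant c u + mean_fun c u * (v - u) <= cumulant c v.
Proof.
apply: (@tangent_below _ _ setT) => // [x|x y xy _]; first exact: is_derive_cumulant.
exact: mean_fun_ndecr.
Qed.

Lemma cumulant_quadratic c m (u v : R) : lin_range c m u -> lin_range c m v ->
  cumulant c v <=
  cumulant c u + mean_fun c u * (v - u) + curvature c m / 2 * (v - u) ^+ 2.
Proof.
move=> um vm; set K := curvature c m.
pose q (x : R) := K / 2 * x ^+ 2 - cumulant c x.
have qD (x : R) : is_derive x 1 q (K * x - mean_fun c x).
  rewrite (_ : q = (K / 2) *: (id ^+ 2 : R -> R) - cumulant c); last first.
    by apply/funext => z; rewrite /q; congr (_ - _).
  have cD := is_derive_cumulant c x.
  by apply: is_derive_eq; congr (_ - _); rewrite -[LHS]/(K / 2 * (2 * x ^+ 1 * 1)); field.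
suff : q u + (K * u - mean_fun c u) * (v - u) <= q v by rewrite /q; lra.
apply: (@tangent_below q _ (lin_range c m) _ _ qD) => // x y xy; last exact: lin_range_down.
by move=> ym; have := mean_fun_lip ym xy; rewrite -/K; lra.
Qed.

End cumulant.

(** Partial derivatives of the objective are derivatives of functions of one real
variable. *)
Section line_derivative.
Context {R : realType} {k : nat}.

Lemma derive_line (f : 'cV[R]_k -> R) a v (l : R) :
  is_derive (0 : R) 1 (fun t : R => f (t *: v + a)) l -> 'D_v f a = l.
Proof.
case=> _ <-; rewrite /derive.
set F := (X in lim (X @ _) = _); set G := (X in _ = lim (X @ _)).
suff -> : F = G by [].
by apply/funext => h; rewrite /F /G /= scale0r add0r addr0 -[h *: 1]/(h * 1) mulr1.
Qed.

End line_derivative.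

Lemma trmxZ (R : nzRingType) m n (r : R) (M : 'M[R]_(m, n)) :
  (r *: M)^T = r *: M^T.
Proof. exact: linearZ. Qed.

Section objective.
Context {R : realType} {n d : nat} (X : 'M[R]_(n, d)) (c : model R n).
Implicit Types (y : 'cV[R]_n) (u v theta : 'cV[R]_d).

Definition means theta : 'cV[R]_n := \col_i mean_fun c ((X *m theta) i 0).

Lemma objectiveE y theta : objective X c y theta =
  n%:R^-1 * (\sum_i cumulant c ((X *m theta) i 0) - dot y (X *m theta)).
Proof. by rewrite /objective -mulmxA dot_mx addrC. Qed.

Lemma differentiable_objective y theta : differentiable (objective X c y) theta.
Proof.
have lin (w : 'I_d -> R) : differentiable (fun t : 'cV[R]_d => \sum_j w j * t j 0 : R) theta.
  rewrite (_ : (fun _ => _) = \sum_j (w j *: (fun t : 'cV[R]_d => t j 0 : R))); last first.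
    by apply/funext => t; rewrite fct_sumE.
  by apply: differentiable_sum => j; apply: differentiableZ; exact: differentiable_coord.
have Xlin i : differentiable (fun t : 'cV[R]_d => (X *m t) i 0 : R) theta.
  rewrite (_ : (fun _ => _) = (fun t : 'cV[R]_d => \sum_j X i j * t j 0 : R))//.
  by apply/funext => t; rewrite mxE.
rewrite (_ : objective X c y = n%:R^-1 *:
   (\sum_i (cumulant c \o (fun t : 'cV[R]_d => (X *m t) i 0))
    - (fun t => \sum_j (X^T *m y) j 0 * t j 0 : R))); last first.
  apply/funext => t; rewrite objectiveE; congr (_ * (_ - _)).
    by rewrite fct_sumE.
  by rewrite dotC dot_mulmx dotC.
apply: differentiableZ; apply: differentiableB => //.
apply: differentiable_sum => i; apply: differentiable_comp => //.
by apply/derivable1_diffP; have := is_derive_cumulant c ((X *m theta) i 0); case.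
Qed.

Lemma grad_objective y theta : grad (objective X c y) theta =
  n%:R^-1 *: (X^T *m (means theta - y)).
Proof.
apply/colP => j; rewrite !mxE; apply: derive_line.
set z := X *m theta.
have lineE (t : R) : X *m (t *: delta_mx j 0 + theta) = t *: col j X + z.
  by rewrite mulmxDr -scalemxAr -colE.
rewrite (_ : (fun _ => _) = n%:R^-1 *:
   (\sum_i (cumulant c \o (fun t : R => t * X i j + z i 0))
    - (fun t : R => t * dot y (col j X) + dot y z))); last first.
  apply/funext => t; rewrite objectiveE lineE; congr (_ * (_ - _)); last first.
    by rewrite !dotE.
  by rewrite fct_sumE; apply: eq_bigr => i _ /=; rewrite !mxE.
have affD (a b : R) : is_derive (0 : R) 1 (fun t : R => t * a + b) a.
  rewrite (_ : (fun _ => _) = a *: id + cst b :> (R -> R)); last first.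
    by apply/funext => t /=; rewrite mulrC.
  by apply: is_derive_eq; rewrite addr0 -[LHS]/(a * 1) mulr1.
have compD i : is_derive (0 : R) 1 (cumulant c \o (fun t : R => t * X i j + z i 0))
    (mean_fun c (z i 0) * X i j).
  apply: is_derive1_comp; rewrite mul0r add0r; exact: is_derive_cumulant.
apply: is_derive_eq; rewrite -[LHS]/(_ * (_ - _)); congr (_ * _).
rewrite /dot -sumrB; apply: eq_bigr => i _.
by rewrite !mxE mulrBr mulrC (mulrC (y i 0)).
Qed.

Hypothesis n_gt0 : (0 < n)%N.
Let n0 : 0 < n%:R :> R. Proof. by rewrite ltr0n. Qed.

(** [Sigma_hat X] is the Gram matrix of [X] scaled by n^(-1/2). *)
Lemma Sigma_dot h : n%:R^-1 * dot (X *m h) (X *m h) <= opnorm (Sigma_hat X) * dot h h.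
Proof.
set r := Num.sqrt (n%:R^-1 : R).
have rr : r * r = n%:R^-1 by rewrite -expr2 sqr_sqrtr// invr_ge0 ltW.
have -> : Sigma_hat X = (r *: X)^T *m (r *: X).
  by rewrite trmxZ -scalemxAl -scalemxAr scalerA rr.
by rewrite (le_trans _ (gram_dot _ _))// -scalemxAl !dotE mulrA rr.
Qed.

Lemma Sigma_dot_tr z : n%:R^-1 * dot (X^T *m z) (X^T *m z) <= opnorm (Sigma_hat X) * dot z z.
Proof.
set r := Num.sqrt (n%:R^-1 : R).
have rr : r * r = n%:R^-1 by rewrite -expr2 sqr_sqrtr// invr_ge0 ltW.
have -> : Sigma_hat X = (r *: X)^T *m (r *: X).
  by rewrite trmxZ -scalemxAl -scalemxAr scalerA rr.
by rewrite (le_trans _ (gram_dot_tr _ _))// trmxZ -scalemxAl !dotE mulrA rr.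
Qed.

(** The linear predictors stay in the range where A' is Lipschitz: by
Cauchy-Schwarz, |<x_i, theta>| <= b max |x_i| on the ball of radius b. *)
Definition predictor_bound b := b * \big[Num.max/0]_(i < n) norm2 (row i X)^T.

Lemma predictor_range b theta i : 0 < b -> smooth_domain (d := d) c b theta ->
  lin_range c (predictor_bound b) ((X *m theta) i 0).
Proof.
case: c => //= b0; rewrite /ball2/= => tb.
have -> : (X *m theta) i 0 = dot (row i X)^T theta.
  by rewrite mxE; apply: eq_bigr => j _; rewrite !mxE.
rewrite (le_trans (cauchy_schwarz _ _))// mulrC ler_pM//.
exact: le_bigmax_cond.
Qed.

Lemma smooth_constE b : smooth_const X c b = curvature c (predictor_bound b) * opnorm (Sigma_hat X).
Proof. by case: c => [s||] //=; rewrite mul1r. Qed.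

Lemma curvature_ge0 m : 0 <= curvature c m.
Proof. by case: c => [s||] //=; rewrite expR_ge0. Qed.

Lemma mean_fun_dist m a b : lin_range c m a -> lin_range c m b ->
  (mean_fun c a - mean_fun c b) ^+ 2 <= curvature c m ^+ 2 * (a - b) ^+ 2.
Proof.
wlog ab : a b / a <= b => [H ha hb|_ hb].
  have [ab|/ltW ab] := leP a b; first exact: H.
  by rewrite -sqrrN opprB -(sqrrN (a - b)) opprB; exact: H.
rewrite -exprMn -sqrrN opprB -(sqrrN (_ * _)) -mulrN opprB.
by rewrite ler_pXn2r ?nnegrE ?mean_fun_lip ?mulr_ge0 ?curvature_ge0 ?subr_ge0 ?mean_fun_ndecr.
Qed.

(** The gradient is n^-1 X^T applied to a Lipschitz function of [X u], so its
Lipschitz constant picks up one factor sqrt |Sigma| from each of X and X^T. *)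
Lemma objective_smooth b y : 0 < b ->
  L_smooth (smooth_domain c b) (objective X c y) (smooth_const X c b).
Proof.
move=> b0; split=> [u _|u v Su Sv]; first exact: differentiable_objective.
rewrite !grad_objective -scalerBr -mulmxBr opprB addrA subrK.
rewrite smooth_constE; set K := curvature _ _; set O := opnorm _.
have K0 : 0 <= K := curvature_ge0 _.
have O0 : 0 <= O := opnorm_ge0 _.
set m := means u - means v.
rewrite norm2_le ?mulr_ge0// exprMn !sqr_norm2 dotZl dotZr.
have mm : dot m m <= K ^+ 2 * dot (X *m (u - v)) (X *m (u - v)).
  rewrite mulr_sumr; apply: ler_sum => i _; rewrite -!expr2 mulmxBr !mxE.
  have := mean_fun_dist (predictor_range i b0 Su) (predictor_range i b0 Sv).
  by rewrite !mxE.
have n1 : 0 <= n%:R^-1 :> R by rewrite invr_ge0 ltW.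
have := ler_wpM2l n1 (Sigma_dot_tr m); rewrite -/O => /le_trans; apply.
rewrite mulrCA.
have -> : (K * O) ^+ 2 * dot (u - v) (u - v) = O * (K ^+ 2 * (O * dot (u - v) (u - v))) by ring.
rewrite ler_wpM2l// (le_trans (ler_wpM2l n1 mm))// mulrCA ler_wpM2l ?exprn_ge0//.
exact: Sigma_dot.
Qed.

Lemma dot_grad y u w : dot (grad (objective X c y) u) w =
  n%:R^-1 * (\sum_i mean_fun c ((X *m u) i 0) * (X *m w) i 0 - dot y (X *m w)).
Proof.
rewrite grad_objective !dotE dot_mulmx trmxK !dotE; congr (_ * (_ - _)).
by apply: eq_bigr => i _; rewrite mxE.
Qed.

Lemma objective_convex y u v :
  objective X c y u + dot (grad (objective X c y) u) (v - u) <= objective X c y v.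
Proof.
rewrite dot_grad !objectiveE -mulrDr ler_pM2l ?invr_gt0// mulmxBr !dotE.
rewrite addrACA -big_split/=.
rewrite [leLHS](_ : _ = \sum_i (cumulant c ((X *m u) i 0)
    + mean_fun c ((X *m u) i 0) * (X *m v - X *m u) i 0) - dot y (X *m v)); last by ring.
rewrite lerD2r; apply: ler_sum => i _; rewrite [(_ - X *m u) i 0]mxE [(- (X *m u)) i 0]mxE.
exact: cumulant_tangent.
Qed.

Lemma objective_descent b y u v : 0 < b ->
  smooth_domain c b u -> smooth_domain c b v ->
  objective X c y v <= objective X c y u + dot (grad (objective X c y) u) (v - u)
    + smooth_const X c b / 2 * dot (v - u) (v - u).
Proof.
move=> b0 Su Sv; set m := predictor_bound b.
have sq : n%:R^-1 * (curvature c m / 2 * dot (X *m (v - u)) (X *m (v - u)))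
    <= smooth_const X c b / 2 * dot (v - u) (v - u).
  rewrite smooth_constE mulrCA -!mulrA (mulrCA (opnorm _)) ler_wpM2l ?curvature_ge0//.
  by rewrite ler_wpM2l ?invr_ge0// Sigma_dot.
rewrite (le_trans _ (lerD (lexx _) sq))// dot_grad !objectiveE -!mulrDr.
rewrite ler_pM2l ?invr_gt0//; set w := X *m (v - u).
have vE : X *m v = X *m u + w by rewrite -mulmxDr addrC subrK.
rewrite {2}vE dotDr.
suff : \sum_i cumulant c ((X *m v) i 0) <= \sum_i cumulant c ((X *m u) i 0)
    + \sum_i mean_fun c ((X *m u) i 0) * w i 0 + curvature c m / 2 * dot w w by lra.
rewrite mulr_sumr -!big_split/=; apply: ler_sum => i _.
have wE : w i 0 = (X *m v) i 0 - (X *m u) i 0 by rewrite vE [(_ + w) i 0]mxE addrAC subrr add0r.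
rewrite wE -expr2.
by apply: cumulant_quadratic; exact: predictor_range.
Qed.

End objective.

Definition constrain (R : realType) n (c : model R n) d b (u : 'cV[R]_d) :=
  match c with Poisson => clip b u | _ => u end.

Lemma gd_stepE (R : realType) n d (X : 'M[R]_(n, d)) (c : model R n) b eta y theta :
  0 < b -> gd_step X c b eta y theta =
  constrain c b (theta - eta *: grad (objective X c y) theta).
Proof. by move=> b0; rewrite /gd_step; case: c => //; rewrite proj_ball2. Qed.

(** * Orthogonal diagonalisation of real symmetric matrices *)

Section symmetric_eigenvalue.
Local Open Scope sesquilinear_scope.

(** A complex eigenvalue of a real symmetric matrix is real, because
[v A v^*] is; so the characteristic polynomial has a root in [R]. *)
Lemma symmetric_eigenvalue (R : rcfType) n (S : 'M[R]_n.+1) :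
  S^T = S -> exists a, eigenvalue S a.
Proof.
move=> Ssym; pose C : numClosedFieldType := R[i]%C.
pose f : {rmorphism R -> C} := real_complex R.
pose A := map_mx f S.
have [a /[dup] aE /eigenvalueP[v vA v0]] := eigenvalue_closed A (ltn0Sn n).
have Aherm : A ^t* = A.
  apply/matrixP => i j; rewrite !mxE.
  have -> : S j i = S i j by rewrite -[in LHS]Ssym mxE.
  by apply/CrealP; apply/complex_realP; exists (S i j).
have vv : (v *m v ^t*) 0 0 \is Num.real /\ (v *m v ^t*) 0 0 != 0.
  have -> : (v *m v ^t*) 0 0 = \sum_j `|v 0 j| ^+ 2.
    by rewrite mxE; apply: eq_bigr => j _; rewrite !mxE normCK.
  split; first by apply: sum_real => j _; rewrite realX// normr_real.
  apply: contra v0 => /eqP h; apply/eqP/rowP => j; rewrite mxE.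
  apply/eqP; rewrite -normr_eq0 -sqrf_eq0; apply/eqP.
  by apply: (psumr_eq0P _ h) => // k _; rewrite exprn_ge0.
have vAv : v *m A *m v ^t* = a *: (v *m v ^t*) by rewrite vA scalemxAl.
have areal : a \is Num.real.
  have : (v *m A *m v ^t*) 0 0 \is Num.real.
    apply/CrealP; have : (v *m A *m v ^t*) ^t* = v *m A *m v ^t*.
      by rewrite !trmx_mul !map_mxM/= Aherm trmxCK mulmxA.
    by move=> /matrixP/(_ 0 0); rewrite !mxE.
  rewrite vAv mxE; case: vv => vr vn h.
  by rewrite -(mulfK vn a) realM// realV.
have /complex_realP[r ar] := areal.
exists r; move: aE; rewrite !eigenvalue_root_char ar -/(f r).
by rewrite /A -map_char_poly fmorph_root.
Qed.

End symmetric_eigenvalue.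

Section spectral.
Context {R : rcfType}.

Lemma unit_eigenvector n (S : 'M[R]_n.+1) : S^T = S ->
  exists a (v : 'rV[R]_n.+1), v *m v^T = 1 /\ v *m S = a *: v.
Proof.
move=> /symmetric_eigenvalue[a /eigenvalueP[v vS v0]].
have vvE : (v *m v^T) 0 0 = \sum_j v 0 j ^+ 2.
  by rewrite mxE; apply: eq_bigr => j _; rewrite mxE expr2.
set q := (v *m v^T) 0 0 in vvE.
have q0 : 0 < q.
  rewrite lt_neqAle eq_sym vvE sumr_ge0 => [|j _]; last exact: sqr_ge0.
  rewrite andbT; apply: contra v0 => /eqP h; apply/eqP/rowP => j; rewrite mxE.
  apply/eqP; rewrite -sqrf_eq0; apply/eqP.
  by apply: (psumr_eq0P _ h) => // k _; exact: sqr_ge0.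
exists a, ((Num.sqrt q)^-1 *: v); split; last first.
  by rewrite -scalemxAl vS !scalerA mulrC.
apply/matrixP => i j; rewrite !ord1 linearZ/= -scalemxAl -scalemxAr scalerA !mxE/=.
rewrite -[X in _ * X = _]/(\sum_j v 0 j * v^T j 0).
have -> : \sum_j v 0 j * v^T j 0 = q by rewrite /q mxE.
by rewrite -invfM -expr2 sqr_sqrtr ?ltW// mulVf ?gt_eqF.
Qed.

(** The Householder reflection exchanging the first basis vector and [v], or
the identity if they coincide. *)
Lemma reflection_to n (v : 'rV[R]_n.+1) : v *m v^T = 1 ->
  exists H : 'M[R]_n.+1, [/\ H^T = H, H *m H = 1%:M & row 0 H = v].
Proof.
move=> vv; pose e : 'rV[R]_n.+1 := delta_mx 0 0.
have ee : e *m e^T = 1.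
  apply/matrixP => i j; rewrite !ord1 mxE (bigD1 ord0)//= !mxE !eqxx mulr1.
  by rewrite big1 ?addr0// => k /negPf k0; rewrite !mxE k0 mul0r.
have [ve|ve] := eqVneq v e.
  exists 1%:M; split; rewrite ?trmx1 ?mulmx1//.
  by rewrite rowE mulmx1 ve.
have [w wdef] : exists w, w = v - e by exists (v - e).
pose q := (w *m w^T) 0 0.
have wwE : w *m w^T = q%:M by rewrite [LHS]mx11_scalar.
have q0 : q != 0.
  apply: contra ve; rewrite -(subr_eq0 v) -wdef => /eqP h.
  have {}h : \sum_j w 0 j ^+ 2 = 0.
    by rewrite -[RHS]h /q [RHS]mxE; apply: eq_bigr => j _; rewrite [X in _ * X]mxE expr2.
  apply/eqP/rowP => j; rewrite [RHS]mxE.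
  apply/eqP; rewrite -sqrf_eq0; apply/eqP.
  by apply: (psumr_eq0P _ h) => // k _; exact: sqr_ge0.
exists (1%:M - (2 / q) *: (w^T *m w)); split.
- by rewrite linearB/= trmx1 linearZ/= trmx_mul trmxK.
- have ww : w^T *m w *m (w^T *m w) = q *: (w^T *m w).
    by rewrite mulmxA -(mulmxA w^T) wwE mul_mx_scalar scalemxAl.
  rewrite mulmxBl mul1mx mulmxBr mulmx1 -scalemxAl -scalemxAr ww !scalerA.
  have -> : 2 / q * (2 / q) * q = 2 / q + 2 / q by field.
  by rewrite scalerDl opprB addrK subrK.
- rewrite rowE mulmxBr mulmx1 -/e -scalemxAr mulmxA.
  have ewE : e *m w^T = (- (q / 2))%:M.
    have veev : v *m e^T = e *m v^T.
      by apply/matrixP => i j; rewrite !ord1 -[in LHS](trmxK v) -trmx_mul mxE.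
    have : w *m w^T = 2%:R *: (1 - e *m v^T).
      rewrite wdef linearB/= mulmxBl !mulmxBr vv ee veev scaler_nat mulr2n.
      by rewrite opprB.
    rewrite wwE => h.
    rewrite wdef linearB/= mulmxBr ee -opprB; apply/eqP; rewrite raddfN/= eqr_opp.
    rewrite mulrC -scale_scalar_mx h scalerA mulVf ?pnatr_eq0// scale1r eqxx//.
  rewrite ewE mul_scalar_mx scalerA.
  have -> : 2 / q * - (q / 2) = - 1 by field.
  by rewrite scaleN1r opprK wdef addrC subrK.
Qed.

(** The reflection to an eigenvector [v] turns [S] into a block matrix with the
eigenvalue as its first block, by symmetry; the other block is handled by
induction. *)
Lemma symmetric_diagonalizable n (S : 'M[R]_n) : S^T = S ->
  exists (Q : 'M[R]_n) (D : 'rV[R]_n), Q *m Q^T = 1%:M /\ Q *m S *m Q^T = diag_mx D.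
Proof.
elim: n S => [|n IH] S Ssym.
  by exists 1%:M, 0; split; apply/matrixP => -[].
have [a [v [vv vS]]] := unit_eigenvector Ssym.
have [H [Hsym HH Hv]] := reflection_to vv.
rewrite -[n.+1]/(1 + n)%N in S Ssym v vv vS H Hsym HH Hv *.
have [B BE] : exists B : 'M[R]_(1 + n), B = H *m S *m H by exists (H *m S *m H).
have Bsym : B^T = B by rewrite BE !trmx_mul Ssym Hsym mulmxA.
have B0 j : B 0 j = a * (j == 0)%:R.
  have : row 0 B = a *: delta_mx 0 0.
    by rewrite BE !row_mul Hv vS -scalemxAl -Hv -row_mul HH rowE mulmx1.
  by move=> /rowP/(_ j); rewrite !mxE eqxx.
have Bul : ulsubmx B = a%:M.
  by apply/matrixP => i j; rewrite !ord1 !mxE lshift0 B0 eqxx mulr1.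
have Bur : ursubmx B = 0.
  by apply/matrixP => i j; rewrite !ord1 !mxE lshift0 B0 mulr0.
have Bdl : dlsubmx B = 0 by rewrite -Bsym -trmx_ursub Bur trmx0.
have [|Q [D [QQ QD]]] := IH (drsubmx B); first by rewrite trmx_drsub Bsym.
pose K : 'M[R]_(1 + n) := block_mx 1%:M 0 0 Q.
have KT : K^T = block_mx 1%:M 0 0 Q^T by rewrite tr_block_mx trmx1 !trmx0.
exists (K *m H), (row_mx a%:M D); split.
  rewrite trmx_mul Hsym mulmxA -(mulmxA K) HH mulmx1 KT /K mulmx_block.
  by rewrite !mulmx0 !mul0mx mul1mx QQ !addr0 !add0r -scalar_mx_block.
rewrite trmx_mul Hsym !mulmxA -(mulmxA K) -(mulmxA K) -BE.
rewrite -[B]submxK Bul Bur Bdl KT /K !mulmx_block.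
rewrite !mulmx0 !mul0mx !mul1mx !addr0 !add0r mulmx1.
have aE : diag_mx a%:M = a%:M :> 'M[R]_1.
  by apply/matrixP => i j; rewrite !ord1 !mxE !eqxx.
by rewrite QD diag_mx_row aE !mul0mx.
Qed.

End spectral.

(** * Expectation of a product of independent factors *)

Section simple.
Context {dO : measure_display} {O : measurableType dO} {R : realType}.
Import HBNNSimple.
Variables (mu : {measure set O -> \bar R}) (Y W : O -> R) (g : {nnsfun R >-> R}).
Hypothesis mY : measurable_fun setT Y.
Hypothesis mW : measurable_fun setT W.
Hypothesis W0 : forall w, 0 <= W w.

Lemma simple_term_ge0 r w : 0 <= r * \1_(g @^-1` [set r]) (Y w) * W w.
Proof.
rewrite mulr_ge0//; have [r0|r0] := leP 0 r; first by rewrite mulr_ge0.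
by rewrite preimage_nnfun0//= indicE in_set0 mulr0.
Qed.

Lemma integral_simple_mul :
  (\int[mu]_w (g (Y w) * W w)%:E =
  \sum_(r \in range g) r%:E * \int[mu]_w (\1_(g @^-1` [set r]) (Y w) * W w)%:E)%E.
Proof.
have mI r : measurable_fun setT (fun w => \1_(g @^-1` [set r]) (Y w) : R).
  by apply: measurableT_comp => //; exact: measurable_indic.
transitivity (\int[mu]_w (\sum_(r \in range g) (r * \1_(g @^-1` [set r]) (Y w) * W w)%:E))%E.
  apply: eq_integral => w _; rewrite fsumEFin// fimfunE.
  by rewrite !fsbig_finite//= mulr_suml.
rewrite ge0_integral_fsum//; last 2 first.
- move=> r; apply/measurable_EFinP; apply: measurable_funM => //.
  exact: measurable_funM.
- by move=> r w _; rewrite lee_fin simple_term_ge0.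
apply: eq_fsbigr => r; rewrite inE => gr.
under eq_integral do rewrite -mulrA EFinM.
rewrite ge0_integralZl_EFin//; last by case: gr => y _ <-.
- by move=> w _; rewrite lee_fin mulr_ge0.
- by apply/measurable_EFinP; exact: measurable_funM.
Qed.

End simple.

Section change_of_measure.
Context {dO : measure_display} {O : measurableType dO} {R : realType}.
Import HBNNSimple.
Variables (mu : {measure set O -> \bar R}) (nu : {measure set R -> \bar R}).
Variables (Y W : O -> R) (c : R).
Hypothesis mY : measurable_fun setT Y.
Hypothesis mW : measurable_fun setT W.
Hypothesis W0 : forall w, 0 <= W w.
Hypothesis YW : forall A : set R, measurable A ->
  (\int[mu]_w (\1_A (Y w) * W w)%:E = nu A * c%:E)%E.

(** With [Y] the identity this integrates against a density; with [nu] the law of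
[Y], it factors the expectation of a product of independent variables. *)
Lemma change_of_measure (f : R -> R) : measurable_fun setT f ->
  (forall y, 0 <= f y) ->
  (\int[mu]_w (f (Y w) * W w)%:E = \int[nu]_y (f y)%:E * c%:E)%E.
Proof.
move=> mf f0.
have simple (g : {nnsfun R >-> R}) :
    (\int[mu]_w (g (Y w) * W w)%:E = (\int[nu]_y (g y * cst 1 y)%:E) * c%:E)%E.
  rewrite integral_simple_mul// (integral_simple_mul nu g (@measurable_id _ R setT)).
  - rewrite [in RHS]fsbig_finite//= ge0_sume_distrl => [|r _]; last first.
      have [r0|r0] := leP 0 r.
        by rewrite mule_ge0// integral_ge0// => y _; rewrite lee_fin mulr_ge0.
      rewrite integral0_eq ?mule0// => y _.
      by rewrite preimage_nnfun0//= indicE in_set0 mul0r.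
    rewrite -fsbig_finite//=; apply: eq_fsbigr => r _.
    have mr : measurable (g @^-1` [set r]) by exact: measurable_sfunP.
    rewrite YW// -muleA; congr (_ * (_ * _))%E.
    rewrite -[in LHS](setIT (g @^-1` _)) -integral_indic//.
    by apply: eq_integral => y _; rewrite mulr1.
  - exact: measurable_cst.
  - by [].
have mfE : measurable_fun setT (EFin \o f) by exact/measurable_EFinP.
pose g := nnsfun_approx measurableT mfE.
have gf y : (EFin \o g ^~ y) @ \oo --> (f y)%:E.
  by apply: cvg_nnsfun_approx => //= z _; rewrite lee_fin.
have lim d' (O' : measurableType d') (mu' : {measure set O' -> \bar R}) (Y' V : O' -> R) :
    measurable_fun setT Y' -> measurable_fun setT V -> (forall w, 0 <= V w) ->
    ((\int[mu']_w (g n (Y' w) * V w)%:E) @[n --> \oo] --> \int[mu']_w (f (Y' w) * V w)%:E)%E.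
  move=> mY' mV V0.
  rewrite [X in _ --> X](_ : _ = \int[mu']_w limn (fun n => (g n (Y' w) * V w)%:E))%E; last first.
    apply: eq_integral => w _; apply/esym/cvg_lim => //.
    rewrite EFinM (_ : (fun _ => _) = fun n => ((g n (Y' w))%:E * (V w)%:E)%E)//.
    by apply: cvgeZr => //; exact: gf.
  apply: cvg_monotone_convergence => //.
  - move=> n; apply/measurable_EFinP; apply: measurable_funM => //.
    exact: measurableT_comp.
  - by move=> n w _; rewrite lee_fin mulr_ge0.
  - move=> w _ a b ab; rewrite lee_fin ler_wpM2r//.
    exact/lefP/nd_nnsfun_approx.
have l1 := lim _ _ mu Y W mY mW W0.
have l2 := lim _ _ nu id (cst 1) (@measurable_id _ _ setT) (measurable_cst _) (fun=> ler01).
have <- : (\int[nu]_y (f y * cst 1 y)%:E = \int[nu]_y (f y)%:E)%E.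
  by apply: eq_integral => y _; rewrite mulr1.
apply: (cvg_unique _ l1) => //.
rewrite (_ : (fun _ => _) = fun n => ((\int[nu]_y (g n y * cst 1 y)%:E) * c%:E)%E); last first.
  by apply/funext => n; exact: simple.
exact: cvgeZr.
Qed.

End change_of_measure.

Section independence.
Context {dO : measure_display} {O : measurableType dO} {R : realType}.
Variable P : probability O R.

Section product.
Variables (I : finType) (Y : I -> {RV P >-> R}).
Hypothesis Y_indep : mutually_independent Y.

(** Independence is the product rule for indicators; the factors outside [s] are
still indicators, and those in [s] are replaced one at a time. *)
Let prod_expectation_seq (s : seq I) (f : I -> R -> R) (e : I -> R) :
  (forall i, measurable_fun setT (f i)) -> (forall i y, 0 <= f i y) ->
  (forall i, (\int[P]_w (f i (Y i w))%:E = (e i)%:E)%E) ->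
  (forall i, i \notin s -> exists2 B, measurable B & f i = \1_B) ->
  (\int[P]_w (\prod_i f i (Y i w))%:E = (\prod_i e i)%:E)%E.
Proof.
have mY i (B : set R) : measurable B -> measurable (Y i @^-1` B).
  by move=> mB; rewrite -[X in measurable X]setTI; exact: (measurable_funPT (Y i)).
elim: s f e => [|k s IH] f e mf f0 fe fB.
  have {fB} /choice[B fB] : forall i, exists B, measurable B /\ f i = \1_B.
    by move=> i; have [B] := fB i isT; exists B.
  have eE i : P (Y i @^-1` B i) = (e i)%:E.
    rewrite -fe -[in LHS](setIT (_ @^-1` _)) -integral_indic//; last first.
      by apply: mY; case: (fB i).
    by apply: eq_integral => w _; have [_ ->] := fB i; rewrite !indicE.
  have <- : P (\bigcap_(i in [set` [set: I]%SET]) (Y i @^-1` B i)) = (\prod_i e i)%:E.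
    rewrite Y_indep => [|i]; last by case: (fB i).
    by rewrite -prodEFin; apply: eq_big => [i|i _]; rewrite ?inE.
  rewrite -[in RHS](setIT (\bigcap_(i in _) _)) -integral_indic//; last first.
    apply: fin_bigcap_measurable => [|i _]; first exact: finite_finset.
    by apply: mY; case: (fB i).
  apply: eq_integral => w _; congr EFin.
  under eq_bigr => i _ do rewrite (fB i).2 indicE.
  rewrite indicE; have [|] := boolP (w \in _).
    rewrite inE => wB; apply: big1 => i _.
    by rewrite mem_set//; apply: wB; rewrite /= inE.
  rewrite notin_setE => wB.
  have [i iB] : exists i, ~ B i (Y i w).
    by apply/existsNP => wB'; apply: wB => i _; exact: wB'.
  by rewrite (bigD1 i)//= memNset// mul0r.
pose W w := \prod_(i | i != k) f i (Y i w).
pose c := \prod_(i | i != k) e i.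
have mfY i : measurable_fun setT (fun w => f i (Y i w)) by exact: measurableT_comp.
have mW : measurable_fun setT W.
  by rewrite /W; under eq_fun do rewrite big_mkcond; apply: measurable_prod => i _; case: (i != k).
have W0 w : 0 <= W w by apply: prodr_ge0 => i _.
have -> : \prod_i e i = e k * c by rewrite (bigD1 k).
under eq_integral do rewrite (bigD1 k)//= -/(W _).
rewrite (@change_of_measure _ _ _ P (distribution P (Y k)) (Y k) W c)//.
  rewrite (ge0_integral_distribution (Y k)); [|exact/measurable_EFinP|by move=> y; rewrite lee_fin].
  by rewrite EFinM; congr (_ * _)%E; exact: fe.
move=> A mA; have PA : P (Y k @^-1` A) \is a fin_num by rewrite fin_num_measure//; exact: mY.
pose f' i := if i == k then \1_A else f i.
pose e' i := if i == k then fine (P (Y k @^-1` A)) else e i.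
have := IH f' e' _ _ _ _.
have -> : \prod_i e' i = fine (P (Y k @^-1` A)) * c.
  rewrite (bigD1 k)//= /e' eqxx; congr (_ * _).
  by apply: eq_bigr => i /negPf ->.
rewrite EFinM fineK// => <-.
- apply: eq_integral => w _; rewrite (bigD1 k)//= /f' eqxx; congr (_ * _)%:E.
  by apply: eq_bigr => i /negPf ->.
- by move=> i; rewrite /f'; case: eqP => // _; exact: measurable_indic.
- by move=> i y; rewrite /f'; case: eqP.
- move=> i; rewrite /f' /e'; case: eqP => [->|//].
  rewrite fineK// -[in RHS](setIT (_ @^-1` _)) -integral_indic//; last exact: mY.
- move=> i si; rewrite /f'; case: eqVneq => [_|ik]; first by exists A.
  by apply: fB; rewrite inE negb_or ik.
Qed.

Lemma prod_expectation (f : I -> R -> R) (e : I -> R) :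
  (forall i, measurable_fun setT (f i)) -> (forall i y, 0 <= f i y) ->
  (forall i, (\int[P]_w (f i (Y i w))%:E = (e i)%:E)%E) ->
  (\int[P]_w (\prod_i f i (Y i w))%:E = (\prod_i e i)%:E)%E.
Proof.
move=> mf f0 fe; apply: (@prod_expectation_seq (enum I)) => // i.
by rewrite mem_enum.
Qed.

End product.
End independence.

(** * Tail bound for quadratic forms of sub-Gaussian vectors *)

Section gaussian_integrals.
Context {R : realType}.
Local Notation leb := (@lebesgue_measure R).

Lemma normal_pdfN0 (m s x : R) : s != 0 ->
  normal_pdf m s x = normal_peak s * normal_fun m s x.
Proof. by move=> s0; rewrite normal_pdfE. Qed.

(** Completing the square: the weight exp (t x) shifts the mean by t s^2. *)
Lemma gauss_exp_linear (m s t : R) : s != 0 ->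
  (\int[leb]_x (expR (t * x) * normal_pdf m s x)%:E =
   (expR (t * m + (t * s) ^+ 2 / 2))%:E)%E.
Proof.
move=> s0.
transitivity (\int[leb]_x ((expR (t * m + (t * s) ^+ 2 / 2))%:E *
    (normal_pdf (m + t * s ^+ 2) s x)%:E)%E)%E.
  apply: eq_integral => x _; rewrite -EFinM !normal_pdfN0//; congr EFin.
  rewrite mulrCA [RHS]mulrCA; congr (_ * _).
  rewrite /normal_fun -!expRD; congr expR.
  by field; rewrite s0 /=.
rewrite ge0_integralZl_EFin ?expR_ge0//.
- by rewrite integral_normal_pdf mule1.
- by move=> x _; rewrite lee_fin normal_pdf_ge0.
- by apply/measurable_EFinP; exact: measurable_normal_pdf.
Qed.

(** [1 - x] is the precision of the tilted Gaussian weight. *)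
Lemma gauss_exp_square (x : R) : x < 1 ->
  (\int[leb]_g (expR (x * g ^+ 2 / 2) * normal_pdf 0 1 g)%:E =
   ((Num.sqrt (1 - x))^-1)%:E)%E.
Proof.
move=> x1; have p0 : 0 < 1 - x by rewrite subr_gt0.
set p := 1 - x in p0 *; set q := Num.sqrt p.
have q0 : 0 < q by rewrite sqrtr_gt0.
have qq : q ^+ 2 = p by rewrite sqr_sqrtr// ltW.
transitivity (\int[leb]_g ((q^-1)%:E * (normal_pdf 0 q^-1 g)%:E)%E)%E.
  apply: eq_integral => g _; rewrite -EFinM !normal_pdfN0 ?invr_eq0 ?gt_eqF//; congr EFin.
  rewrite mulrCA [RHS]mulrA; congr (_ * _).
    rewrite /normal_peak expr1n mul1r exprVn -mulrnAr sqrtrM ?invr_ge0 ?sqr_ge0//.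
    rewrite -exprVn sqrtr_sqr ger0_norm ?invr_ge0 ?ltW//.
    by rewrite invfM invrK mulrA mulVf ?mul1r ?gt_eqF.
  rewrite /normal_fun -!expRD; congr expR.
  have -> : x = 1 - q ^+ 2 by rewrite qq /p; ring.
  by field; rewrite gt_eqF.
rewrite ge0_integralZl_EFin ?invr_ge0 ?ltW//.
- by rewrite integral_normal_pdf mule1.
- by move=> g _; rewrite lee_fin normal_pdf_ge0.
- by apply/measurable_EFinP; exact: measurable_normal_pdf.
Qed.

(** With y = - ln u, this is y <= sinh y. *)
Lemma ln_inv_le (u : R) : 0 < u <= 1 -> - ln u <= (u^-1 - u) / 2.
Proof.
move=> /andP[u0 u1]; set y := - ln u.
have y0 : 0 <= y by rewrite oppr_ge0 ln_le0.
have uE : u = expR (- y) by rewrite /y opprK lnK.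
have uVE : u^-1 = expR y by rewrite uE expRN invrK.
rewrite uVE [in X in _ <= X]uE.
pose h (z : R) := expR z - expR (- z) - 2 * z.
pose dh (z : R) := expR z + expR (- z) - 2.
have hD (z : R) : is_derive z 1 h (dh z).
  rewrite (_ : h = @expR R - (@expR R \o -%R) - 2 *: id)//.
  have e : is_derive z 1 (@expR R \o -%R) (expR (- z) * - 1).
    by apply: is_derive1_comp.
  by apply: is_derive_eq; rewrite -[2 *: 1]/(2 * 1) mulr1 mulrN1 opprK.
have [|c _ hc] := @MVT_segment R h dh _ _ y0 (fun z _ => hD z).
  apply: continuous_subspaceT => z.
  by apply/differentiable_continuous/derivable1_diffP; exact: ex_derive.
have : 0 <= h y - h 0.
  rewrite hc subr0 mulr_ge0// /dh expRN.
  have -> : expR c + (expR c)^-1 - 2 = (expR c - 1) ^+ 2 / expR c.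
    by field; rewrite gt_eqF ?expR_gt0.
  by rewrite divr_ge0 ?sqr_ge0 ?expR_ge0.
by rewrite /h oppr0 mulr0 subr0 subrr subr0; lra.
Qed.

(** The factor (1 - x)^(-1/2) of a Gaussian integral, with its linear part, which
will add up to the trace, and its quadratic part, which will add up to the
squared Frobenius norm. *)
Lemma inv_sqrt_le (x m : R) : 0 <= x <= m -> m < 1 ->
  (Num.sqrt (1 - x))^-1 <= expR (x / 2 + x ^+ 2 / (4 * (1 - m))).
Proof.
move=> /andP[x0 xm] m1; have p0 : 0 < 1 - x by lra.
have -> : (Num.sqrt (1 - x))^-1 = expR (- ln (1 - x) / 2).
  have pE : 1 - x = expR (ln (1 - x) / 2) ^+ 2.
    by rewrite -expRM_natl mulrC divfK ?lnK// pnatr_eq0.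
  by rewrite [in LHS]pE sqrtr_sqr ger0_norm ?expR_ge0// -expRN mulNr.
rewrite ler_expR.
have u01 : 0 < 1 - x <= 1 by lra.
have := ln_inv_le u01.
have -> : (1 - x)^-1 - (1 - x) = 2 * x + x ^+ 2 / (1 - x) by field; rewrite gt_eqF.
have : x ^+ 2 / (1 - x) <= x ^+ 2 / (1 - m).
  by rewrite ler_wpM2l ?sqr_ge0// lef_pV2 ?posrE//; lra.
have -> : x ^+ 2 / (4 * (1 - m)) = x ^+ 2 / (1 - m) / 4.
  by field; rewrite gt_eqF//; lra.
by lra.
Qed.

End gaussian_integrals.

Section quadratic_form.
Context {dO : measure_display} {O : measurableType dO} {R : realType}.
Context (P : probability O R) {n : nat}.
Variables (E : O -> 'cV[R]_n) (G : O -> R) (tau : R).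
Hypothesis mE : forall i, measurable_fun setT (fun w => E w i 0).
Hypothesis mG : measurable_fun setT G.
Hypothesis G_ge0 : forall w, 0 <= G w.
Hypothesis subgaussian : forall a : 'cV[R]_n,
  (\int[P]_w (G w * expR (dot a (E w)))%:E <= (expR (tau * dot a a))%:E)%E.
Local Notation leb := (@lebesgue_measure R).

Lemma measurable_dot (a : 'cV[R]_n) : measurable_fun setT (fun w => dot a (E w)).
Proof.
by apply: measurable_sum => i; apply: measurable_funM => //; exact: measurable_cst.
Qed.

(** Each square is linearised by exp (u^2 / 2) = E exp (g u), with g a standard
Gaussian variable.  Orthogonality keeps the variance proxies additive: the
vector [a + g r_k] has squared norm |a|^2 + g^2 |r_k|^2. *)
Lemma quadratic_mgf k (r : nat -> 'cV[R]_n) (a : 'cV[R]_n) :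
  (forall i j, (i < j < k)%N -> dot (r i) (r j) = 0) ->
  (forall j, (j < k)%N -> 2 * tau * dot (r j) (r j) < 1) ->
  (forall j, (j < k)%N -> dot (r j) a = 0) ->
  (\int[P]_w (G w * expR (dot a (E w) + \sum_(0 <= j < k) dot (r j) (E w) ^+ 2 / 2))%:E
   <= (\prod_(0 <= j < k) (Num.sqrt (1 - 2 * tau * dot (r j) (r j)))^-1
       * expR (tau * dot a a))%:E)%E.
Proof.
elim: k a => [|k IH] a rr r1 ra.
  rewrite big_nil mul1r (le_trans _ (subgaussian a))// le_eqVlt; apply/orP; left.
  by apply/eqP/eq_integral => w _; rewrite big_nil addr0.
set C := \prod_(0 <= j < k) (Num.sqrt (1 - 2 * tau * dot (r j) (r j)))^-1.
have C0 : 0 <= C by apply: prodr_ge0 => j _; rewrite invr_ge0 sqrtr_ge0.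
pose S w := \sum_(0 <= j < k) dot (r j) (E w) ^+ 2 / 2.
have mS : measurable_fun setT S.
  apply: measurable_sum => j; apply: measurable_funM => //.
  by apply: measurable_funX; exact: measurable_dot.
pose F (z : O * R) : \bar R := (G z.1 * expR (dot a (E z.1) + S z.1)
   * (expR (dot (r k) (E z.1) * z.2) * normal_pdf 0 1 z.2))%:E.
have mF : measurable_fun setT F.
  apply/measurable_EFinP; apply: measurable_funM.
    apply: (@measurableT_comp _ _ _ _ _ _ (fun w => G w * expR (dot a (E w) + S w)) _ fst) => //.
    apply: measurable_funM => //; apply: measurableT_comp => //.
    by apply: measurable_funD => //; exact: measurable_dot.
  apply: measurable_funM.
    apply: measurableT_comp => //; apply: measurable_funM => //.
    by apply: (@measurableT_comp _ _ _ _ _ _ (fun w => dot (r k) (E w)) _ fst) => //; exact: measurable_dot.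
  by apply: (@measurableT_comp _ _ _ _ _ _ (normal_pdf 0 1) _ snd) => //; exact: measurable_normal_pdf.
have F0 z : (0 <= F z)%E.
  by rewrite lee_fin !mulr_ge0 ?expR_ge0 ?normal_pdf_ge0.
have one0 : (1 : R) != 0 by [].
have -> : (\int[P]_w (G w * expR (dot a (E w) + \sum_(0 <= j < k.+1) dot (r j) (E w) ^+ 2 / 2))%:E
    = \int[P]_w \int[leb]_g F (w, g))%E.
  apply: eq_integral => w _; rewrite big_nat_recr//= -/(S w).
  under eq_integral do rewrite /F/= EFinM.
  rewrite ge0_integralZl_EFin ?mulr_ge0 ?expR_ge0//; last 2 first.
  - by move=> g _; rewrite lee_fin mulr_ge0 ?expR_ge0 ?normal_pdf_ge0.
  - apply/measurable_EFinP; apply: measurable_funM; last exact: measurable_normal_pdf.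
    by apply: measurableT_comp => //; exact: measurable_funM.
  rewrite gauss_exp_linear// mulr0 add0r mulr1 -EFinM; congr EFin.
  by rewrite addrA [in LHS]expRD mulrA.
rewrite (@fubini_tonelli _ _ _ _ R P leb F)//.
have inner (g : R) : (\int[P]_w F (w, g) <=
   (C * expR (tau * dot a a))%:E *
   (expR (2 * tau * dot (r k) (r k) * g ^+ 2 / 2) * normal_pdf 0 1 g)%:E)%E.
  have ak : dot (r k) a = 0 by exact: ra.
  have := IH (a + g *: r k) _ _ _.
  have -> : tau * dot (a + g *: r k) (a + g *: r k)
      = tau * dot a a + 2 * tau * dot (r k) (r k) * g ^+ 2 / 2.
    by rewrite !dotE (dotC a (r k)) ak; field.
  move=> h.
  have {}h : (\int[P]_w (G w * expR (dot (a + g *: r k) (E w) + S w))%:E <=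
     (C * expR (tau * dot a a + 2 * tau * dot (r k) (r k) * g ^+ 2 / 2))%:E)%E.
    apply: h => [i j /andP[ij jk]|j jk|j jk].
    - by apply: rr; rewrite ij ltnS ltnW.
    - by apply: r1; rewrite ltnS ltnW.
    - have jkk : (j < k < k.+1)%N by rewrite jk ltnSn.
      by rewrite !dotE (ra j (leqW jk)) (rr j k jkk) mulr0 addr0.
  have -> : (\int[P]_w F (w, g) = (normal_pdf 0 1 g)%:E *
      \int[P]_w (G w * expR (dot (a + g *: r k) (E w) + S w))%:E)%E.
    rewrite -ge0_integralZl_EFin ?normal_pdf_ge0//; last 2 first.
    - by move=> w _; rewrite lee_fin mulr_ge0 ?expR_ge0.
    - apply/measurable_EFinP; apply: measurable_funM => //.
      apply: measurableT_comp => //; apply: measurable_funD => //.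
      exact: measurable_dot.
    apply: eq_integral => w _; rewrite -EFinM; congr EFin.
    rewrite /= !dotE [RHS]mulrCA -!mulrA; congr (_ * _).
    rewrite !mulrA -expRD [RHS]mulrC; congr (expR _ * _); ring.
  apply: (@le_trans _ _ ((normal_pdf 0 1 g)%:E *
    (C * expR (tau * dot a a + 2 * tau * dot (r k) (r k) * g ^+ 2 / 2))%:E)%E).
    by rewrite lee_wpmul2l// lee_fin normal_pdf_ge0.
  rewrite -!EFinM lee_fin expRD le_eqVlt; apply/orP; left; apply/eqP; ring.
have mpdf : measurable_fun setT (fun g : R =>
    expR (2 * tau * dot (r k) (r k) * g ^+ 2 / 2) * normal_pdf 0 1 g).
  apply: measurable_funM; last exact: measurable_normal_pdf.
  apply: measurableT_comp => //; apply: measurable_funM => //.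
  by apply: measurable_funM => //; exact: measurable_funX.
apply: (@le_trans _ _ (\int[leb]_g ((C * expR (tau * dot a a))%:E *
   (expR (2 * tau * dot (r k) (r k) * g ^+ 2 / 2) * normal_pdf 0 1 g)%:E))%E).
  apply: ge0_le_integral => //.
  - by move=> g _; exact: integral_ge0.
  - exact: (measurable_fun_fubini_tonelli_G F).
  - by under eq_fun do rewrite -EFinM; apply/measurable_EFinP; exact: measurable_funM.
rewrite ge0_integralZl_EFin ?mulr_ge0 ?expR_ge0//; last 2 first.
- by move=> g _; rewrite lee_fin mulr_ge0 ?expR_ge0 ?normal_pdf_ge0.
- exact/measurable_EFinP.
by rewrite gauss_exp_square ?r1// -EFinM lee_fin big_nat_recr//= -/C mulrAC.
Qed.

End quadratic_form.

Section gram_spectrum.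
Context {R : realType} {d n : nat} (M : 'M[R]_(d, n)).
Local Notation S := (M *m M^T).

(** Rotating the rows of [M] to the eigenbasis of its Gram matrix makes them
orthogonal, without changing |M e|. *)
Lemma gram_rotation : exists (r : 'I_d -> 'cV[R]_n) (D : 'I_d -> R),
  [/\ forall e, dot (M *m e) (M *m e) = \sum_j dot (r j) e ^+ 2,
      forall i j, dot (r i) (r j) = D j *+ (i == j),
      \sum_j D j = \tr S,
      \sum_j D j ^+ 2 = frobenius S ^+ 2
    & forall j, 0 <= D j <= opnorm S].
Proof.
have Ssym : S^T = S by rewrite trmx_mul trmxK.
have [Q [D [QQ QD]]] := symmetric_diagonalizable Ssym.
have QQ' : Q^T *m Q = 1%:M by exact: mulmx1C.
pose r j := (row j (Q *m M))^T.
have rE j e : dot (r j) e = (Q *m (M *m e)) j 0.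
  by rewrite mulmxA [RHS]mxE; apply: eq_bigr => i _; rewrite mxE mxE.
have rr i j : dot (r i) (r j) = D 0 j *+ (i == j).
  have <- : (Q *m S *m Q^T) i j = D 0 j *+ (i == j).
    by rewrite QD mxE; case: eqP => [->|].
  have -> : Q *m S *m Q^T = (Q *m M) *m (Q *m M)^T by rewrite trmx_mul !mulmxA.
  by rewrite [RHS]mxE; apply: eq_bigr => k _; rewrite !mxE.
exists r, (fun j => D 0 j); split => //.
- move=> e; have <- : dot (Q *m (M *m e)) (Q *m (M *m e)) = dot (M *m e) (M *m e).
    by rewrite (dot_mulmx Q) (mulmxA Q^T) QQ' mul1mx.
  by apply: eq_bigr => j _; rewrite rE expr2.
- have : \tr (Q *m S *m Q^T) = \tr S by rewrite mxtrace_mulC (mulmxA Q^T) QQ' mul1mx.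
  by rewrite QD mxtrace_diag.
- rewrite /frobenius sqr_sqrtr; last first.
    by apply: sumr_ge0 => i _; apply: sumr_ge0 => j _; exact: sqr_ge0.
  have -> : \sum_i \sum_j S i j ^+ 2 = \tr (S *m S).
    apply: eq_bigr => i _; rewrite [RHS]mxE; apply: eq_bigr => j _.
    by rewrite expr2; congr (_ * _); rewrite -[in LHS]Ssym mxE.
  have <- : \tr (Q *m S *m Q^T *m (Q *m S *m Q^T)) = \tr (S *m S).
    have -> : Q *m S *m Q^T *m (Q *m S *m Q^T) = Q *m (S *m S) *m Q^T.
      by rewrite !mulmxA -(mulmxA _ Q^T Q) QQ' mulmx1.
    by rewrite mxtrace_mulC (mulmxA Q^T) QQ' mul1mx.
  rewrite QD mul_diag_mx; apply: eq_bigr => j _.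
  by rewrite !mxE eqxx expr2.
- move=> j; have := rr j j; rewrite eqxx mulr1n => Dj; rewrite -Dj dot_ge0 /=.
  pose q := (row j Q)^T.
  have qq : dot q q = 1.
    have : (Q *m Q^T) j j = 1 by rewrite QQ mxE eqxx.
    by rewrite mxE => <-; apply: eq_bigr => k _; rewrite !mxE.
  have rq : r j = M^T *m q by rewrite /r row_mul trmx_mul.
  rewrite rq dot_mulmx trmxK mulmxA dotC (le_trans (cauchy_schwarz _ _))//.
  have nq : norm2 q = 1 by rewrite norm2E qq sqrtr1.
  by rewrite (le_trans (ler_wpM2r _ (norm2_mulmx_opnorm _ _)))// nq !mulr1.
Qed.

End gram_spectrum.

Section tail.
Context {dO : measure_display} {O : measurableType dO} {R : realType}.
Context (P : probability O R) {n d : nat}.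
Variables (E : O -> 'cV[R]_n) (A : set O) (sigma : R) (M : 'M[R]_(d, n)).
Hypothesis mE : forall i, measurable_fun setT (fun w => E w i 0).
Hypothesis mA : measurable A.
Hypothesis sigma_gt0 : 0 < sigma.
Hypothesis subgaussian : forall a : 'cV[R]_n,
  (\int[P]_w (\1_A w * expR (dot a (E w)))%:E
   <= (expR (sigma ^+ 2 / 2 * dot a a))%:E)%E.
Local Notation S := (M *m M^T).

Definition quadratic_level (delta : R) :=
  sigma ^+ 2 * (\tr S + 2 * Num.sqrt delta * frobenius S + 2 * delta * opnorm S).

Lemma measurable_quadratic : measurable_fun setT (fun w => dot (M *m E w) (M *m E w)).
Proof.
have mM i : measurable_fun setT (fun w => (M *m E w) i 0).
  under eq_fun do rewrite mxE.
  by apply: measurable_sum => j; exact: measurable_funM.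
by apply: measurable_sum => i; exact: measurable_funM.
Qed.

(** Chernoff's bound.  With V = sigma^2 |S|_F and c = sigma^2 |S|_op, the moment
generating function at s is at most
exp (s sigma^2 tr S + s^2 V^2 / (1 - 2 s c)), and s is chosen so that the
exponent becomes exactly - delta. *)
Lemma quadratic_tail (delta : R) : 0 < delta -> 0 < frobenius S ->
  (P (A `&` [set w | (quadratic_level delta < dot (M *m E w) (M *m E w))%R])
   <= (expR (- delta))%:E)%E.
Proof.
move=> d0 F0.
have [r [D [Mr rr trD FD D01]]] := gram_rotation M.
set Op := opnorm S in D01.
have Op0 : 0 <= Op := opnorm_ge0 _.
have s2 : 0 < sigma ^+ 2 by rewrite exprn_gt0.
pose rd := Num.sqrt delta.
have rd0 : 0 < rd by rewrite sqrtr_gt0.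
have rdE : rd ^+ 2 = delta by rewrite sqr_sqrtr// ltW.
pose V := sigma ^+ 2 * frobenius S; pose c := sigma ^+ 2 * Op.
have V0 : 0 < V by rewrite mulr_gt0.
have c0 : 0 <= c by rewrite mulr_ge0// ltW.
have Vc0 : 0 < V + 2 * c * rd by rewrite ltr_pwDl// !mulr_ge0// ltW.
(* with this exponent, 1 - 2 s c = V / (V + 2 c sqrt delta) *)
pose s := rd / (V + 2 * c * rd).
have s0 : 0 < s by rewrite divr_gt0.
pose m := 2 * s * c.
have mE' : 1 - m = V / (V + 2 * c * rd).
  by rewrite /m /s; field; rewrite gt_eqF.
have m1 : m < 1 by rewrite -subr_gt0 mE' divr_gt0.
pose x j := 2 * s * sigma ^+ 2 * D j.
have x01 j : 0 <= x j <= m.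
  have /andP[Dj0 DjO] := D01 j.
  have k0 : 0 <= 2 * s * sigma ^+ 2.
    by apply: mulr_ge0; last exact: ltW; apply: mulr_ge0 => //; exact: ltW.
  apply/andP; split; first exact: mulr_ge0.
  by rewrite /m /c mulrA ler_wpM2l.
pose t := quadratic_level delta.
pose q w := dot (M *m E w) (M *m E w).
pose k := Num.sqrt (2 * s).
have kk : k ^+ 2 = 2 * s by rewrite sqr_sqrtr// mulr_ge0// ltW.
(* the scaling turns u^2 / 2 into s u^2; indices beyond [d] never occur *)
pose r' (j : nat) : 'cV[R]_n := if insub j is Some i then k *: r i else 0.
have r'E (i : 'I_d) : r' i = k *: r i by rewrite /r' valK.
have r'r' i j : (i < j < d)%N -> dot (r' i) (r' j) = 0.
  move=> /andP[ij jd]; have id := ltn_trans ij jd.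
  rewrite (r'E (Ordinal id)) (r'E (Ordinal jd)) !dotE rr.
  by rewrite -val_eqE/= ltn_eqF// mulr0n !mulr0.
have r'x (i : 'I_d) : 2 * (sigma ^+ 2 / 2) * dot (r' i) (r' i) = x i.
  rewrite r'E !dotE rr eqxx mulr1n.
  have -> : 2 * (sigma ^+ 2 / 2) * (k * (k * D i)) = sigma ^+ 2 * k ^+ 2 * D i by field.
  by rewrite kk /x; ring.
have mG : measurable_fun setT (\1_A : O -> R) by exact: measurable_indic.
have := @quadratic_mgf _ _ _ P _ E \1_A _ mE mG _ subgaussian d r' 0 r'r' _ _.
rewrite dot0l mulr0 expR0 mulr1 => H.
have {}H : (\int[P]_w (\1_A w * expR (s * q w))%:E <=
    (\prod_(j < d) (Num.sqrt (1 - x j))^-1)%:E)%E.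
  have -> : \prod_(j < d) (Num.sqrt (1 - x j))^-1 = \prod_(0 <= j < d)
      (Num.sqrt (1 - 2 * (sigma ^+ 2 / 2) * dot (r' j) (r' j)))^-1.
    by rewrite big_mkord; apply: eq_bigr => i _; rewrite r'x.
  rewrite [leLHS](_ : _ = (\int[P]_w (\1_A w *
    expR (dot 0 (E w) + \sum_(0 <= j < d) dot (r' j) (E w) ^+ 2 / 2))%:E)%E); last first.
    apply: eq_integral => w _; congr (_ * expR _)%:E.
    rewrite dot0l add0r big_mkord /q Mr mulr_sumr; apply: eq_bigr => j _.
    by rewrite r'E !dotE exprMn kk; field.
  apply: H => // j jd.
  - rewrite (r'x (Ordinal jd)) (le_lt_trans _ m1)//.
    by have /andP[] := x01 (Ordinal jd).
  - by rewrite dotC dot0l.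
have prodE : \prod_(j < d) (Num.sqrt (1 - x j))^-1 <= expR (s * t - delta).
  apply: (@le_trans _ _ (\prod_(j < d) expR (x j / 2 + x j ^+ 2 / (4 * (1 - m))))).
    apply: ler_prod => j _; rewrite invr_ge0 sqrtr_ge0/=.
    exact: inv_sqrt_le.
  rewrite -expR_sum ler_expR big_split/= -!mulr_suml.
  have -> : \sum_(j < d) x j = 2 * s * sigma ^+ 2 * \tr S by rewrite -trD mulr_sumr.
  have -> : \sum_(j < d) x j ^+ 2 = 4 * s ^+ 2 * V ^+ 2.
    have -> : 4 * s ^+ 2 * V ^+ 2 = 4 * s ^+ 2 * sigma ^+ 4 * frobenius S ^+ 2.
      by rewrite /V; ring.
    by rewrite -FD mulr_sumr; apply: eq_bigr => j _; rewrite /x; ring.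
  have -> : s * t - delta = s * sigma ^+ 2 * \tr S + (2 * s * rd * V + 2 * s * delta * c - delta).
    by rewrite /t /quadratic_level -/rd -/Op /V /c; ring.
  rewrite -rdE mE' le_eqVlt; apply/orP; left; apply/eqP.
  by rewrite /s; field; rewrite !gt_eqF.
pose B := A `&` [set w | t < q w].
have mB : measurable B.
  apply: measurableI => //; rewrite -[X in measurable X]setTI.
  by apply: measurable_fun_ltr => //; exact: measurable_quadratic.
rewrite -/B -[B]setIT -integral_indic//.
apply: (@le_trans _ _ (\int[P]_w ((expR (- (s * t)))%:E * (\1_A w * expR (s * q w))%:E))%E).
  apply: ge0_le_integral => //.
  - by apply/measurable_EFinP; exact: measurable_indic.
  - under eq_fun do rewrite -EFinM; apply/measurable_EFinP; apply: measurable_funM => //.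
    apply: measurable_funM => //; apply: measurableT_comp => //.
    by apply: measurable_funM => //; exact: measurable_quadratic.
  - move=> w _; rewrite -EFinM lee_fin mulrCA -expRD !indicE.
    have [|] := boolP (w \in B); last by rewrite mulr_ge0 ?ler0n ?expR_ge0.
    rewrite inE => -[Aw /= tq]; rewrite mem_set// mul1r -expR0 ler_expR.
    by rewrite -mulrN -mulrDr mulr_ge0 ?(ltW s0)// addrC subr_ge0 ltW.
rewrite ge0_integralZl_EFin ?expR_ge0//; last first.
- apply/measurable_EFinP; apply: measurable_funM => //; apply: measurableT_comp => //.
  by apply: measurable_funM => //; exact: measurable_quadratic.
apply: (@le_trans _ _ ((expR (- (s * t)))%:E * (expR (s * t - delta))%:E)%E).
  by rewrite lee_wpmul2l ?lee_fin ?expR_ge0// (le_trans H)// lee_fin.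
by rewrite -EFinM -expRD addrA addNr add0r.
Qed.

End tail.

(** * Sub-Gaussian responses *)

Section subgaussian_vector.
Context {dO : measure_display} {O : measurableType dO} {R : realType}.
Context (P : probability O R) {n : nat} (Y : 'I_n -> {RV P >-> R}).
Variables (mu : 'cV[R]_n) (B : 'I_n -> set R) (v : R).
Hypothesis Y_indep : mutually_independent Y.
Hypothesis mB : forall i, measurable (B i).
Hypothesis mgf : forall i (a : R),
  (\int[P]_w (\1_(B i) (Y i w) * expR (a * (Y i w - mu i 0)))%:E
   <= (expR (v * a ^+ 2))%:E)%E.

(** The exponential of a linear form is a product over the responses, and so is
the indicator of the truncation event. *)
Lemma indep_mgf (a : 'cV[R]_n) :
  (\int[P]_w (\1_(\bigcap_(i in [set: 'I_n]) Y i @^-1` B i) w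
     * expR (dot a (responses Y w - mu)))%:E <= (expR (v * dot a a))%:E)%E.
Proof.
pose f i (y : R) := \1_(B i) y * expR (a i 0 * (y - mu i 0)).
have f0 i y : 0 <= f i y by rewrite mulr_ge0 ?expR_ge0.
have mf i : measurable_fun setT (f i).
  apply: measurable_funM; first exact: measurable_indic.
  apply: measurableT_comp => //; apply: measurable_funM => //.
  exact: measurable_funB.
have int0 i : (0 <= \int[P]_w (f i (Y i w))%:E)%E.
  by apply: integral_ge0 => w _; rewrite lee_fin.
pose e i := fine (\int[P]_w (f i (Y i w))%:E).
have eE i : (\int[P]_w (f i (Y i w))%:E = (e i)%:E)%E.
  by rewrite fineK// ge0_fin_numE// (le_lt_trans (mgf i (a i 0)))// ltry.
have := prod_expectation Y_indep mf f0 eE.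
rewrite [X in (X <= _)%E](_ : _ = \int[P]_w (\prod_i f i (Y i w))%:E)%E; last first.
  apply: eq_integral => w _; rewrite big_split/= -expR_sum; congr (_ * expR _)%:E.
    rewrite indicE; have [|] := boolP (w \in _).
      rewrite inE => wB; rewrite big1// => i _.
      by rewrite indicE mem_set//; exact: wB.
    rewrite notin_setE => wB.
    have [i iB] : exists i, ~ B i (Y i w).
      by apply/existsNP => wB'; apply: wB => i _; exact: wB'.
    by rewrite (bigD1 i)//= indicE memNset// mul0r.
  by apply: eq_bigr => i _; rewrite !mxE.
move=> ->; rewrite lee_fin.
have -> : v * dot a a = \sum_i v * a i 0 ^+ 2.
  by rewrite mulr_sumr; apply: eq_bigr => i _; rewrite expr2.
rewrite expR_sum; apply: ler_prod => i _.
by rewrite -!lee_fin -eE int0 /=; exact: mgf.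
Qed.

End subgaussian_vector.

Section mgf.
Context {R : realType}.

Lemma gaussian_mgf (m s a : R) : s != 0 ->
  (\int[@lebesgue_measure R]_y (expR (a * (y - m)) * normal_pdf m s y)%:E
   = (expR (s ^+ 2 / 2 * a ^+ 2))%:E)%E.
Proof.
move=> s0.
have E y : (expR (a * (y - m)) * normal_pdf m s y)%:E =
    ((expR (- (a * m)))%:E * (expR (a * y) * normal_pdf m s y)%:E)%E.
  by rewrite -EFinM mulrA -expRD; congr (expR _ * _)%:E; ring.
under eq_integral do rewrite E.
rewrite ge0_integralZl_EFin ?expR_ge0//; last 2 first.
- by move=> y _; rewrite lee_fin mulr_ge0 ?expR_ge0 ?normal_pdf_ge0.
- apply/measurable_EFinP; apply: measurable_funM; last exact: measurable_normal_pdf.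
  by apply: measurableT_comp => //; exact: measurable_funM.
rewrite gauss_exp_linear// -EFinM -expRD; congr (expR _)%:E.
by field.
Qed.

(** Hoeffding's bound, read off the curvature 1/4 of the logistic cumulant at the
log-odds of [p]. *)
Lemma bernoulli_mgf (p a : R) : 0 <= p <= 1 ->
  p * expR (a * (1 - p)) + (1 - p) * expR (a * (0 - p)) <= expR (8^-1 * a ^+ 2).
Proof.
move=> /andP[]; rewrite le_eqVlt => /predU1P[<- _|p0].
  by rewrite mul0r add0r subr0 mul1r subrr mulr0 ler_expR mulr_ge0 ?sqr_ge0// invr_ge0.
rewrite le_eqVlt => /predU1P[->|p1].
  by rewrite subrr mulr0 mul0r addr0 mul1r ler_expR mulr_ge0 ?sqr_ge0// invr_ge0.
have q0 : 0 < 1 - p by rewrite subr_gt0.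
have o0 : 0 < p / (1 - p) by rewrite divr_gt0.
pose z := ln (p / (1 - p)).
have zE : expR z = p / (1 - p) by rewrite lnK.
have := @cumulant_quadratic R 0 Bernoulli 0 z (z + a) I I.
have -> : z + a - z = a by ring.
rewrite /= expRD zE.
have -> : p / (1 - p) / (1 + p / (1 - p)) = p by field; rewrite gt_eqF //= lt0r_neq0 //; lra.
have -> : 1 + p / (1 - p) = (1 - p)^-1 by field; rewrite gt_eqF.
rewrite lnV ?posrE// -(ler_expR (ln _)) lnK; last first.
  by rewrite posrE addr_gt0// mulr_gt0 ?expR_gt0.
rewrite -addrA expRD expRN lnK ?posrE// -(ler_pM2l q0) mulrA divff ?gt_eqF// mul1r.
rewrite mulrDr mulr1 mulrA [(1 - p) * (p / _)]mulrC divfK ?gt_eqF// => h.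
have := ler_wpM2r (expR_ge0 (- (a * p))) h; rewrite -expRD.
have -> : p * a + 4^-1 / 2 * a ^+ 2 - a * p = 8^-1 * a ^+ 2 by field.
rewrite mulrDl -mulrA -expRD => h'; apply: (le_trans _ h').
by rewrite sub0r mulrN addrC mulrBr mulr1.
Qed.

End mgf.

Section laws.
Context {dO : measure_display} {O : measurableType dO} {R : realType}.
Context (P : probability O R) (Y : {RV P >-> R}).

(** A law given as the image by [Z] of the density [W] with respect to [nu]:
Lebesgue measure for the Gaussian law, the counting measure for the Poisson
law. *)
Lemma expectation_of_law dT (T : measurableType dT) (nu : {measure set T -> \bar R})
    (Z W : T -> R) :
  measurable_fun setT Z -> measurable_fun setT W -> (forall t, 0 <= W t) ->
  (forall A : set R, measurable A ->
     (\int[nu]_t (\1_A (Z t) * W t)%:E = distribution P Y A)%E) ->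
  forall f : R -> R, measurable_fun setT f -> (forall y, 0 <= f y) ->
  (\int[P]_w (f (Y w))%:E = \int[nu]_t (f (Z t) * W t)%:E)%E.
Proof.
move=> mZ mW W0 ZW f mf f0.
rewrite (@change_of_measure _ _ _ nu (distribution P Y) Z W 1 mZ mW W0)//; last first.
  by move=> A mA; rewrite ZW// mule1.
rewrite mule1 (ge0_integral_distribution Y)//; exact/measurable_EFinP.
Qed.

(** Outside its parameter range a discrete law degenerates to the point mass at 0;
the mean [m] is then 0. *)
Lemma mean_of_null_law (m : R) : ('E_P[Y] = m%:E)%E ->
  (\int[P]_w `|Y w|%:E = 0)%E -> m = 0.
Proof.
rewrite expectation_def => Ym Y0.
have := @le_abse_integral _ _ _ P setT (EFin \o Y) measurableT _.
rewrite Ym /= Y0 => h; apply/eqP; rewrite -normr_le0 -lee_fin; apply: h.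
by apply/measurable_EFinP; exact: measurable_funPT.
Qed.

Let mexp (a m : R) : measurable_fun setT (fun y : R => expR (a * (y - m))).
Proof.
by apply: measurableT_comp => //; apply: measurable_funM => //; exact: measurable_funB.
Qed.

Lemma gaussian_law_mgf (m s a : R) :
  (forall A, measurable A -> distribution P Y A = gaussian_law m s A) ->
  (\int[P]_w (expR (a * (Y w - m)))%:E = (expR (s ^+ 2 / 2 * a ^+ 2))%:E)%E.
Proof.
rewrite /gaussian_law; have [->|s0] := eqVneq s 0 => YA.
  rewrite expr0n/= !mul0r expR0.
  rewrite (@expectation_of_law _ _ (\d_m : {measure set R -> \bar R}) id (cst 1) _ _ _ _
    (fun y : R => expR (a * (y - m))))//.
  - rewrite integral_dirac//= ?diracT ?subrr ?mulr0 ?expR0 ?mulr1 ?mule1//.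
    apply/measurable_EFinP; apply: measurable_funM => //.
  - move=> A mA; rewrite YA// integral_dirac//=.
      by rewrite diracT mul1e mulr1 diracE indicE.
    by apply/measurable_EFinP; apply: measurable_funM => //; exact: measurable_indic.
rewrite (@expectation_of_law _ _ (@lebesgue_measure R) id (normal_pdf m s) _ _ _ _
    (fun y : R => expR (a * (y - m))))//.
- exact: gaussian_mgf.
- exact: measurable_normal_pdf.
- by move=> y; exact: normal_pdf_ge0.
- move=> A mA; rewrite YA// /normal_prob [RHS]integral_mkcond; apply: eq_integral => y _.
  by rewrite /patch/= indicE; case: ifP; rewrite ?mul1r ?mul0r.
Qed.

Lemma bernoulli_law_mgf (p a : R) : ('E_P[Y] = p%:E)%E ->
  (forall A : set R, measurable A -> distribution P Y A =
     pushforward (bernoulli_prob p) (fun y : bool => y%:R : R) A) ->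
  (\int[P]_w (expR (a * (Y w - p)))%:E <= (expR (8^-1 * a ^+ 2))%:E)%E.
Proof.
move=> Yp YA.
have E := @expectation_of_law _ _ (bernoulli_prob p : {measure set bool -> \bar R})
  (fun y : bool => y%:R : R) (cst 1) _ _ _ _.
have {}E (f : R -> R) : measurable_fun setT f -> (forall y, 0 <= f y) ->
    (\int[P]_w (f (Y w))%:E = \int[bernoulli_prob p]_y (f (y%:R))%:E)%E.
  move=> mf f0; rewrite E//; first by apply: eq_integral => y _; rewrite mulr1.
  move=> A mA; rewrite YA// /pushforward -[X in bernoulli_prob p X]setIT -integral_indic//.
  by apply: eq_integral => y _; rewrite mulr1 !indicE.
have [p01|p01] := boolP (0 <= p <= 1).
  rewrite (E (fun y => expR (a * (y - p))))//.
  rewrite integral_bernoulli_prob//.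
  by rewrite -!EFinM -EFinD lee_fin bernoulli_mgf.
have p0 : p = 0.
  apply: mean_of_null_law => //.
  rewrite (E (fun y => `|y|))//.
  rewrite (@eq_measure_integral _ _ _ setT \d_false)//; last first.
    by move=> A mA _; rewrite /= /bernoulli_prob (negbTE p01).
  by rewrite integral_dirac//= diracT mul1e normr0.
by rewrite p0 lexx ler01 in p01.
Qed.

End laws.

Section poisson.
Context {R : realType}.

Lemma sum_poisson_pmf (m : R) : 0 < m ->
  (\sum_(k <oo) (poisson_pmf m k)%:E = 1)%E.
Proof.
move=> m0; rewrite nneseries_esumT => [|k]; last by rewrite lee_fin poisson_pmf_ge0.
have := probability_setT (poisson_prob m 0 : probability nat R).
by rewrite /= /poisson_prob m0.
Qed.

(** The weight e^(a k) turns the Poisson weights of mean m into those of mean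
m e^a, up to a factor. *)
Lemma poisson_mgf (m a : R) : 0 < m ->
  (\int[counting]_k (expR (a * (k%:R - m)) * poisson_pmf m k)%:E
   = (expR (m * (expR a - 1 - a)))%:E)%E.
Proof.
move=> m0; have m'0 : 0 < m * expR a by rewrite mulr_gt0 ?expR_gt0.
rewrite ge0_integral_count => [|k]; last first.
  by rewrite lee_fin mulr_ge0 ?expR_ge0 ?poisson_pmf_ge0.
have E k : (expR (a * (k%:R - m)) * poisson_pmf m k)%:E =
    ((expR (m * (expR a - 1 - a)))%:E * (poisson_pmf (m * expR a) k)%:E)%E.
  rewrite -EFinM; congr EFin; rewrite /poisson_pmf m0 m'0 exprMn -expRM_natl.
  rewrite [LHS](_ : _ = m ^+ k * k`!%:R^-1 * (expR (a * (k%:R - m)) * expR (- m))); last by ring.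
  rewrite [RHS](_ : _ = m ^+ k * k`!%:R^-1 * (expR (m * (expR a - 1 - a)) * expR (k%:R * a)
     * expR (- (m * expR a)))); last by ring.
  by congr (_ * _); rewrite -!expRD; congr expR; ring.
under eq_eseriesr do rewrite E.
rewrite nneseriesZl => [|k _]; last by rewrite lee_fin poisson_pmf_ge0.
by rewrite sum_poisson_pmf// mule1.
Qed.

(** From e^(-a/2) >= 1 - a/2 >= 0, hence e^a <= (1 - a/2)^(-2). *)
Lemma expR_le_quadratic (a : R) : a <= 1 -> expR a <= 1 + a + 4 * a ^+ 2.
Proof.
move=> a1; have e := expR_ge1Dx (- a / 2); have e0 := expR_gt0 (- a / 2).
have b0 : 0 < 1 + - a / 2 by lra.
have E : expR a * expR (- a / 2) ^+ 2 = 1.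
  by rewrite -expRM_natl -expRD (_ : a + _ = 0) ?expR0//; field.
have sq : (1 + - a / 2) ^+ 2 <= expR (- a / 2) ^+ 2.
  by rewrite ler_pXn2r ?nnegrE ?(ltW b0) ?(ltW e0).
have h1 : expR a * (1 + - a / 2) ^+ 2 <= 1.
  by rewrite -[leRHS]E ler_wpM2l ?expR_ge0.
have h2 : 1 <= (1 + a + 4 * a ^+ 2) * (1 + - a / 2) ^+ 2.
  have -> : (1 + a + 4 * a ^+ 2) * (1 + - a / 2) ^+ 2
    = 1 + a ^+ 2 * ((1 - a) * (11 / 4 - a) + 2^-1) by field.
  rewrite lerDl mulr_ge0 ?sqr_ge0// addr_ge0 ?invr_ge0// mulr_ge0//; lra.
by have := le_trans h1 h2; rewrite ler_pM2r ?exprn_gt0.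
Qed.

Lemma expR1_le3 : expR 1 <= 3 :> R.
Proof.
(* (1 - 1/6)^6 > 1/3 *)
have e := expR_ge1Dx (- 6^-1 : R).
have h : (1 - 6^-1) ^+ 6 <= expR (- 6^-1) ^+ 6 :> R.
  rewrite ler_pXn2r ?nnegrE ?expR_ge0//; lra.
have E : expR (- 6^-1) ^+ 6 = (expR 1)^-1 :> R.
  by rewrite -expRM_natl mulrN mulfV ?expRN.
have : 3^-1 <= (expR 1)^-1 :> R.
  by rewrite -E (le_trans _ h)//; lra.
by rewrite lef_pV2 ?posrE ?expR_gt0.
Qed.

Lemma ln_ge1 n : (3 <= n)%N -> 1 <= ln n%:R :> R.
Proof.
move=> n3; rewrite -[leLHS]expRK ler_ln ?posrE ?expR_gt0 ?ltr0n ?(leq_trans _ n3)//.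
by rewrite (le_trans expR1_le3)// ler_nat.
Qed.

End poisson.

Section poisson_law.
Context {dO : measure_display} {O : measurableType dO} {R : realType}.
Context (P : probability O R) (Y : {RV P >-> R}) (m : R).
Hypothesis Y_mean : ('E_P[Y] = m%:E)%E.
Hypothesis Y_law : forall A : set R, measurable A -> distribution P Y A =
     pushforward (poisson_prob m 0) (fun k : nat => k%:R : R) A.

Let mexp (a : R) : measurable_fun setT (fun y : R => expR (a * (y - m))).
Proof.
by apply: measurableT_comp => //; apply: measurable_funM => //; exact: measurable_funB.
Qed.

Lemma poisson_law_mgf (a : R) : 0 <= m /\
  (\int[P]_w (expR (a * (Y w - m)))%:E = (expR (m * (expR a - 1 - a)))%:E)%E.
Proof.
have [m0|m0] := ltP 0 m.
  split; first exact: ltW.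
  rewrite -poisson_mgf// (@expectation_of_law _ _ _ P Y _ nat counting
    (fun k : nat => k%:R : R) (poisson_pmf m) _ _ _ _ (fun y => expR (a * (y - m))))//.
  - by move=> k; exact: poisson_pmf_ge0.
  - move=> A mA; rewrite Y_law// /pushforward /poisson_prob m0.
    rewrite ge0_integral_count => [|k]; last by rewrite lee_fin mulr_ge0 ?poisson_pmf_ge0.
    rewrite nneseries_esumT => [|k]; last by rewrite lee_fin mulr_ge0 ?poisson_pmf_ge0.
    rewrite [RHS]esum_mkcond; apply: eq_esum => k _.
    rewrite indicE; case: ifP => [|].
      by rewrite inE => kA; rewrite mem_set// mul1r.
    by move=> /negbT; rewrite notin_setE => kA; rewrite memNset// mul0r.
have E := @expectation_of_law _ _ _ P Y _ R (\d_(0 : R) : {measure set R -> \bar R}) id (cst 1) _ _ _ _.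
have {}E (f : R -> R) : measurable_fun setT f -> (forall y, 0 <= f y) ->
    (\int[P]_w (f (Y w))%:E = (f 0)%:E)%E.
  move=> mf f0; rewrite E//.
  - rewrite integral_dirac//= ?diracT ?mul1e ?mulr1//.
    by apply/measurable_EFinP; exact: measurable_funM.
  - move=> A mA; rewrite Y_law// /pushforward /poisson_prob ltNge m0/=.
    rewrite integral_dirac//=; last first.
      by apply/measurable_EFinP; apply: measurable_funM => //; exact: measurable_indic.
    by rewrite diracT mul1e mulr1 !diracE indicE.
have me : m = 0.
  apply: mean_of_null_law Y_mean _.
  by rewrite (E (fun y => `|y|))// normr0.
rewrite me lexx; split => //.
by rewrite (E (fun y => expR (a * (y - 0))))//= ?subr0 ?mulr0 ?mul0r// -me.
Qed.

Variables (M x sigma : R).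
Hypothesis mM : m <= M.
Hypothesis sigma_ge0 : 0 <= sigma.
Hypothesis x_ge2 : 2 <= x.
Hypothesis x_le : x <= sigma.
Hypothesis M_le : 9 * M <= sigma ^+ 2.

(** For a <= 1 the Poisson exponent m (e^a - 1 - a) is at most 4 m a^2, and
9 m <= sigma^2.  For a > 1 it grows too fast, but on the truncation event a (Y - m) <= a x, which is
below sigma^2 a^2 / 2 because 2 <= x <= sigma. *)
Lemma poisson_truncated_mgf (a : R) :
  (\int[P]_w (\1_[set y | (y <= m + x)%R] (Y w) * expR (a * (Y w - m)))%:E
   <= (expR (sigma ^+ 2 / 2 * a ^+ 2))%:E)%E.
Proof.
have [m0 mgf] := poisson_law_mgf a.
have mI : measurable_fun setT (fun w => \1_[set y : R | y <= m + x] (Y w) : R).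
  apply: measurableT_comp => //; apply: measurable_indic.
  rewrite (_ : [set y | _] = `]-oo, (m + x)]%classic); first exact: measurable_itv.
  by apply/seteqP; split => y /=; rewrite in_itv.
have mY : measurable_fun setT (fun w => expR (a * (Y w - m))).
  exact: (measurableT_comp (mexp a)).
have [a1|a1] := leP a 1.
  apply: (@le_trans _ _ (\int[P]_w (expR (a * (Y w - m)))%:E)%E).
    apply: ge0_le_integral => //.
    - by apply/measurable_EFinP; exact: measurable_funM.
    - by apply/measurable_EFinP.
    - by move=> w _; rewrite lee_fin ler_piMl ?expR_ge0// indicE lern1 leq_b1.
  rewrite mgf lee_fin ler_expR.
  have h := expR_le_quadratic a1.
  have : m * (expR a - 1 - a) <= m * (4 * a ^+ 2) by rewrite ler_wpM2l//; lra.
  have : 8 * m * a ^+ 2 <= sigma ^+ 2 * a ^+ 2.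
    by rewrite ler_wpM2r ?sqr_ge0//; move: m0 mM M_le; lra.
  by lra.
apply: (@le_trans _ _ (\int[P]_w cst (expR (sigma ^+ 2 / 2 * a ^+ 2))%:E w)%E); last first.
  by rewrite integral_cst//= probability_setT mule1.
apply: ge0_le_integral => //.
- by apply/measurable_EFinP; exact: measurable_funM.
- move=> w _; rewrite lee_fin indicE; have [|] := boolP (Y w \in _); last first.
    by rewrite mul0r expR_ge0.
  rewrite inE/= mul1r => Yx; rewrite ler_expR.
  have : a * (Y w - m) <= a * x by rewrite ler_wpM2l//; lra.
  have : x * x <= sigma * sigma by rewrite ler_pM//; move: x_ge2; lra.
  have : 2 * x <= x * x by rewrite ler_wpM2r//; move: x_ge2; lra.
  move=> h1 h2 h3.
  have : a * (2 * x) <= a * (a * (sigma * sigma)).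
    rewrite ler_wpM2l//; first lra.
    by rewrite (le_trans h1)// (le_trans h2)// ler_peMl ?mulr_ge0//; lra.
  by rewrite !expr2; lra.
Qed.

(** Chernoff's bound with exponent 1. *)
Lemma poisson_upper_tail : (P (Y @^-1` ~` [set y | (y <= m + x)%R])
   <= (expR (m - x))%:E)%E.
Proof.
have [m0 mgf] := poisson_law_mgf 1.
have mS : measurable [set y : R | y <= m + x].
  rewrite (_ : [set y | _] = `]-oo, (m + x)]%classic); first exact: measurable_itv.
  by apply/seteqP; split => y /=; rewrite in_itv.
have mB : measurable (Y @^-1` ~` [set y | (y <= m + x)%R]).
  rewrite -[X in measurable X]setTI; apply: (measurable_funPT Y) => //.
  exact: measurableC.
have mY : measurable_fun setT (fun w => expR (1 * (Y w - m))).
  exact: (measurableT_comp (mexp 1)).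
rewrite -[Y @^-1` _]setIT -integral_indic//.
apply: (@le_trans _ _ (\int[P]_w ((expR (- x))%:E * (expR (1 * (Y w - m)))%:E))%E).
  apply: ge0_le_integral => //.
  - by apply/measurable_EFinP; exact: measurable_indic.
  - under eq_fun do rewrite -EFinM.
    by apply/measurable_EFinP; apply: measurable_funM.
  - move=> w _; rewrite -EFinM lee_fin -expRD indicE.
    have [|_] := boolP (w \in _); last by rewrite expR_ge0.
    rewrite inE/= => /negP; rewrite -ltNge => xY.
    by rewrite -[leLHS]expR0 ler_expR; lra.
rewrite ge0_integralZl_EFin ?expR_ge0//; last exact/measurable_EFinP.
rewrite mgf -EFinM -expRD lee_fin ler_expR.
have := @expR1_le3 R; have : m * (expR 1 - 1 - 1) <= m * 1.
  by rewrite ler_wpM2l//; have := @expR1_le3 R; lra.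
by lra.
Qed.

End poisson_law.

(** * Measurability of the iterates *)

Section measurability.
Context {dO : measure_display} {O : measurableType dO} {R : realType}.
Context {n d : nat} (X : 'M[R]_(n, d)) (c : model R n).

Definition measurable_col k (u : O -> 'cV[R]_k) :=
  forall i, measurable_fun setT (fun w => u w i 0).

Lemma measurable_col_mulmx k l (M : 'M[R]_(k, l)) (u : O -> 'cV[R]_l) :
  measurable_col u -> measurable_col (fun w => M *m u w).
Proof.
move=> mu i; under eq_fun do rewrite mxE.
by apply: measurable_sum => j; exact: measurable_funM.
Qed.

Lemma measurable_colZ k a (u : O -> 'cV[R]_k) :
  measurable_col u -> measurable_col (fun w => a *: u w).
Proof. by move=> mu i; under eq_fun do rewrite mxE; exact: measurable_funM. Qed.

Lemma measurable_colB k (u v : O -> 'cV[R]_k) :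
  measurable_col u -> measurable_col v -> measurable_col (fun w => u w - v w).
Proof.
by move=> mu mv i; under eq_fun do rewrite !mxE; exact: measurable_funB.
Qed.

Lemma measurable_mean_fun : measurable_fun setT (mean_fun c).
Proof.
case: c => [s||] /=; [exact: measurable_id| |exact: measurable_expR].
rewrite (_ : mean_fun _ = fun u => expR (u - ln (1 + expR u))); last first.
  apply/funext => u; rewrite expRD expRN lnK// posrE.
  by rewrite ltr_pwDr// expR_gt0.
apply: measurableT_comp => //; apply: measurable_funB => //.
by apply: measurableT_comp => //; apply: measurable_funD => //; exact: measurable_expR.
Qed.

Lemma measurable_cumulant : measurable_fun setT (cumulant c).
Proof.
apply: continuous_measurable_fun => u.
have h := is_derive_cumulant c u.
by apply/differentiable_continuous/derivable1_diffP; exact: ex_derive.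
Qed.

Lemma measurable_clip k b (u : O -> 'cV[R]_k) : measurable_col u ->
  measurable_col (fun w => clip b (u w)).
Proof.
move=> mu i.
have mn : measurable_fun setT (fun w => norm2 (u w)).
  rewrite (_ : (fun w => _) = fun w => (dot (u w) (u w)) `^ 2^-1); last first.
    by apply/funext => w; rewrite norm2E powR12_sqrt// dot_ge0.
  apply: (measurableT_comp (measurable_powR _)).
  by apply: measurable_sum => j; exact: measurable_funM.
rewrite (_ : (fun w => _) = fun w => if norm2 (u w) <= b then u w i 0
    else b * norm2 (u w) `^ (-1) * u w i 0); last first.
  apply/funext => w; rewrite /clip; case: ifP => // _.
  by rewrite mxE powR_inv1.
apply: measurable_fun_ifT => //.
- by apply: measurable_fun_ler => //; exact: measurable_cst.
- apply: measurable_funM => //; apply: measurable_funM => //.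
  exact: (measurableT_comp (measurable_powR _)).
Qed.

Lemma measurable_constrain b (u : O -> 'cV[R]_d) : measurable_col u ->
  measurable_col (fun w => constrain c b (u w)).
Proof. by case: c => [s||] // mu; exact: measurable_clip. Qed.

Lemma measurable_gd (b eta : R) (y : O -> 'cV[R]_n) T : 0 < b ->
  measurable_col y -> measurable_col (fun w => gd X c b eta (y w) T).
Proof.
move=> b0 my; elim: T => [|T IH].
  by move=> i; under eq_fun do rewrite mxE; exact: measurable_cst.
under [X in measurable_col X]eq_fun do rewrite /gd iterS gd_stepE// -/(gd _ _ _ _ _ _).
apply: measurable_constrain; apply: measurable_colB => //; apply: measurable_colZ.
under [X in measurable_col X]eq_fun do rewrite grad_objective.
apply: measurable_colZ; apply: measurable_col_mulmx; apply: measurable_colB => //.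
move=> i; under eq_fun do rewrite mxE.
by apply: (measurableT_comp measurable_mean_fun); exact: measurable_col_mulmx.
Qed.

Lemma measurable_objective (y : 'cV[R]_n) (theta : O -> 'cV[R]_d) :
  measurable_col theta -> measurable_fun setT (fun w => objective X c y (theta w)).
Proof.
move=> mt; under eq_fun do rewrite objectiveE.
have mX := measurable_col_mulmx X mt.
apply: measurable_funM => //; apply: measurable_funB.
  by apply: measurable_sum => i; apply: (measurableT_comp measurable_cumulant).
by apply: measurable_sum => i; exact: measurable_funM.
Qed.

End measurability.

(** * The excess risk of gradient descent *)

Section risk.
Context {dO : measure_display} {O : measurableType dO} {R : realType}.
Context (P : probability O R) {n d : nat} (X : 'M[R]_(n, d)) (c : model R n).
Context (Y : 'I_n -> {RV P >-> R}) (mu : 'cV[R]_n).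
Hypothesis Y_mean : forall i, ('E_P[Y i] = (mu i 0)%:E)%E.

Lemma integrable_response i : P.-integrable setT (EFin \o Y i).
Proof.
have mY : measurable_fun setT (EFin \o Y i).
  by apply/measurable_EFinP; exact: measurable_funPT.
apply/integrableP; split => //; apply/abse_integralP => //.
by have := Y_mean i; rewrite expectation_def => ->; rewrite /= ltry.
Qed.

(** The objective is affine in the responses, so its expectation over a fresh
copy is its value at the means. *)
Lemma riskE : risk X c Y = objective X c mu.
Proof.
apply/funext => theta; rewrite /risk; apply: EFin_inj.
pose k := n%:R^-1 * \sum_i cumulant c ((X *m theta) i 0).
pose z i := - (n%:R^-1 * (X *m theta) i 0).
have objE (y : 'cV[R]_n) : objective X c y theta = k + \sum_i z i * y i 0.
  rewrite objectiveE mulrBr; congr (_ + _).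
  by rewrite mulr_sumr -sumrN; apply: eq_bigr => i _; rewrite /z; ring.
have iY i : P.-integrable setT (fun w => (z i)%:E * (Y i w)%:E)%E.
  by apply: integrableZl => //; exact: integrable_response.
rewrite unlock; set I := (\int[P]_w _)%E.
have -> : I = (objective X c mu theta)%:E; last by [].
rewrite /I.
transitivity (\int[P]_w (k%:E + \sum_i (z i)%:E * (Y i w)%:E))%E.
  apply: eq_integral => w _; rewrite objE EFinD sumEFin; congr (_ + (_)%:E)%E.
  by apply: eq_bigr => i _; rewrite mxE.
rewrite integralD//; last 2 first.
- exact: finite_measure_integrable_cst.
- exact: integrable_sum.
rewrite integral_cst//= probability_setT mule1 integral_sum// objE EFinD -sumEFin.
congr (_ + _)%E; apply: eq_bigr => i _.
rewrite integralZl//; last exact: integrable_response.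
by have := Y_mean i; rewrite expectation_def => ->.
Qed.

End risk.

Section excess.
Context {R : realType} {n d : nat} (X : 'M[R]_(n, d)) (c : model R n).
Implicit Types (y mu : 'cV[R]_n) (u theta : 'cV[R]_d).

(** The slope of the risk relative to the objective built on [y]. *)
Definition score y mu : 'cV[R]_d := n%:R^-1 *: (X^T *m (y - mu)).

Lemma objective_tilt y mu theta :
  objective X c mu theta = objective X c y theta + dot (score y mu) theta.
Proof.
rewrite !objectiveE /score dotZl dot_mulmx trmxK !dotE -mulrDr; congr (_ * _).
by ring.
Qed.

(** When no minimiser exists [argmin] is the centre of the ball. *)
Lemma argmin_ball2 k b (g : 'cV[R]_k -> R) : 0 < b -> ball2 b (argmin (ball2 b) g).
Proof.
move=> b0; rewrite /argmin; case: xgetP => [u _ []//|_].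
by rewrite /ball2/= norm2E dot0l sqrtr0 ltW.
Qed.

Lemma gd_excess (b eta kappa : R) y mu u T : (0 < n)%N -> 0 < b ->
  0 < eta <= 1 / smooth_const X c b -> ball2 b u ->
  dot (score y mu) (score y mu) <= kappa ^+ 2 ->
  let x := gd X c b eta y T in
  (2 * eta * T%:R * (objective X c mu x - objective X c mu u)
   <= b ^+ 2 + (eta * T%:R) ^+ 2 * kappa ^+ 2 : Prop).
Proof.
move=> n0 b0 /andP[eta0 etaL] ub vk x.
have b0' : ball2 (k := d) b 0 by rewrite /ball2/= norm2E dot0l sqrtr0 ltW.
set S := smooth_domain (d := d) c b.
have ballS w : ball2 b w -> S w by rewrite /S; case: c.
have etaL' : eta * smooth_const X c b <= 1.
  have L0 : 0 < smooth_const X c b.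
    by move: (lt_le_trans eta0 etaL); rewrite div1r invr_gt0.
  by rewrite -ler_pdivlMr.
have := @descent_tilted R d (objective X c y) (grad (objective X c y))
  (gd_step X c b eta y) S (smooth_const X c b) eta eta0 etaL' _ _ _ _ T u (score y mu)
  (ballS _ b0') (ballS _ ub).
rewrite -/(gd X c b eta y T) -/x !(objective_tilt y mu) => H.
apply: le_trans (H _ _ _ _) _ => {H}.
- by move=> v w _ _; exact: objective_convex.
- by move=> v w Sv Sw; exact: objective_descent.
- move=> v; rewrite gd_stepE// /S /constrain; case: c => //= _.
  exact: clip_ball.
- move=> v w _; rewrite gd_stepE// /S /constrain; case: c => [s||] /=.
  + by rewrite subrr dot0l.
  + by rewrite subrr dot0l.
  + exact: clip_obtuse.
- rewrite lerD// ?ler_wpM2l ?sqr_ge0//.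
  by move: ub; rewrite /ball2/= norm2_le// ltW.
Qed.

End excess.

(** With [lambda = kappa / b], stopping at [eta T = lambda^-1] balances the two
terms; rounding [T] up costs at most [eta] in the second one. *)
Lemma balanced_rate (R : realFieldType) (b lambda tau e r : R) :
  0 < b -> 0 < lambda -> 0 <= e ->
  lambda^-1 <= tau <= lambda^-1 + e ->
  2 * tau * r <= b ^+ 2 + tau ^+ 2 * (b * lambda) ^+ 2 ->
  r <= b ^+ 2 * lambda + e / 2 * (b * lambda) ^+ 2.
Proof.
move=> b0 l0 e0 /andP[t1 t2] h.
have li : 0 < lambda^-1 by rewrite invr_gt0.
have t0 : 0 < tau := lt_le_trans li t1.
have tl : 1 <= tau * lambda by rewrite -ler_pdivrMr// div1r.
have tl2 : tau * lambda <= 1 + e * lambda.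
  have -> : 1 + e * lambda = (lambda^-1 + e) * lambda by field; rewrite gt_eqF.
  by rewrite ler_wpM2r// ltW.
have tt0 : 0 < 2 * tau by rewrite mulr_gt0.
rewrite -(ler_pM2l tt0) (le_trans h)//.
have b2 : 0 < b ^+ 2 by rewrite exprn_gt0.
have -> : b ^+ 2 + tau ^+ 2 * (b * lambda) ^+ 2 = b ^+ 2 * (1 + (tau * lambda) ^+ 2) by ring.
have -> : 2 * tau * (b ^+ 2 * lambda + e / 2 * (b * lambda) ^+ 2)
   = b ^+ 2 * ((tau * lambda) * (2 + e * lambda)) by field.
rewrite ler_pM2l//; set z := tau * lambda in tl tl2 *.
have el : 0 <= e * lambda by rewrite mulr_ge0// ltW.
by set f := e * lambda in tl2 el *; nra.
Qed.

Section noise.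
Context {dO : measure_display} {O : measurableType dO} {R : realType}.
Context (P : probability O R) {n d : nat} (X : 'M[R]_(n, d)).
Context (Y : 'I_n -> {RV P >-> R}) (mu : 'cV[R]_n) (B : 'I_n -> set R) (sigma : R).
Hypothesis n_gt0 : (0 < n)%N.
Hypothesis Y_indep : mutually_independent Y.
Hypothesis mB : forall i, measurable (B i).
Hypothesis sigma_gt0 : 0 < sigma.
Hypothesis mgf : forall i (a : R),
  (\int[P]_w (\1_(B i) (Y i w) * expR (a * (Y i w - mu i 0)))%:E
   <= (expR (sigma ^+ 2 / 2 * a ^+ 2))%:E)%E.

Definition typical : set O := \bigcap_(i in [set: 'I_n]) Y i @^-1` B i.

Lemma measurable_preimage_response i (A : set R) :
  measurable A -> measurable (Y i @^-1` A).
Proof.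
by move=> mA; rewrite -[X in measurable X]setTI; exact: (measurable_funPT (Y i)).
Qed.

Lemma measurable_typical : measurable typical.
Proof.
apply: fin_bigcap_measurable => [|i _]; first exact: finite_finset.
exact: measurable_preimage_response.
Qed.

Lemma measurable_responses : measurable_col (responses Y).
Proof.
by move=> i; under eq_fun do rewrite mxE; exact: (measurable_funPT (Y i)).
Qed.

Lemma complexity_frobenius delta : 0 < complexity X delta -> 0 < frobenius (Sigma_hat X).
Proof.
move=> C0; rewrite lt_neqAle sqrtr_ge0 andbT eq_sym; apply/eqP => F0.
have S0 : Sigma_hat X = 0.
  have s0 i : 0 <= \sum_j Sigma_hat X i j ^+ 2 by apply: sumr_ge0 => j _; exact: sqr_ge0.
  have : \sum_i \sum_j Sigma_hat X i j ^+ 2 <= 0.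
    by rewrite -sqrtr_eq0; apply/eqP.
  rewrite le_eqVlt ltNge sumr_ge0//= orbF => /eqP h.
  apply/matrixP => i j; rewrite [RHS]mxE; apply/eqP; rewrite -sqrf_eq0; apply/eqP.
  have hi : \sum_j Sigma_hat X i j ^+ 2 = 0 by apply: (psumr_eq0P _ h).
  by apply: (psumr_eq0P _ hi) => // k _; exact: sqr_ge0.
have op0 : opnorm (Sigma_hat X) = 0.
  rewrite S0; apply/eqP; rewrite eq_le opnorm_ge0 andbT.
  apply: ge_sup => [|_ [v _ <-]]; first by case: (opnorm_has_sup (0 : 'M[R]_d)).
  by rewrite mul0mx norm2E dot0l sqrtr0.
by move: C0; rewrite /complexity F0 op0 S0 mxtrace0 !mulr0 !addr0 ltxx.
Qed.

(** [G] is the event of the theorem; it contains the typical event minus the tail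
event of the quadratic form, since Sigma is the Gram matrix of
M = n^(-1/2) X^T and |score|^2 = |M (Y - mu)|^2 / n. *)
Lemma noise_bound delta eps (G : set O) : 0 < delta ->
  0 < complexity X delta -> measurable G ->
  (P (~` typical) <= eps%:E)%E ->
  (forall w, let v := score X (responses Y w) mu in
     dot v v <= sigma ^+ 2 / n%:R * complexity X delta -> G w) ->
  ((1 - expR (- delta) - eps)%:E <= P G)%E.
Proof.
move=> d0 C0 mG Peps vG.
have n0 : 0 < n%:R :> R by rewrite ltr0n.
pose M := (Num.sqrt n%:R)^-1 *: X^T.
have qq : (Num.sqrt n%:R)^-1 * (Num.sqrt n%:R)^-1 = n%:R^-1 :> R.
  by rewrite -invfM -expr2 sqr_sqrtr// ltW.
have MM : M *m M^T = Sigma_hat X.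
  by rewrite /M trmxZ trmxK -scalemxAl -scalemxAr scalerA qq.
pose E w := responses Y w - mu.
have mE : measurable_col E.
  apply: measurable_colB; first exact: measurable_responses.
  by move=> i; exact: measurable_cst.
have MF : 0 < frobenius (M *m M^T) by rewrite MM; exact: complexity_frobenius C0.
have sub (a : 'cV[R]_n) : (\int[P]_w (\1_typical w * expR (dot a (E w)))%:E
   <= (expR (sigma ^+ 2 / 2 * dot a a))%:E)%E.
  exact: indep_mgf.
have := quadratic_tail mE measurable_typical sigma_gt0 sub d0 MF.
set bad := typical `&` _ => Pbad.
have mbad : measurable bad.
  apply: measurableI; first exact: measurable_typical.
  rewrite -[X in measurable X]setTI.
  by apply: measurable_fun_ltr => //; exact: measurable_quadratic.
have mT : measurable (~` typical) by apply: measurableC; exact: measurable_typical.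
have GC : ~` G `<=` ~` typical `|` bad.
  move=> w Gw; have [tw|tw] := pselect (typical w); [right|by left].
  split => //=; rewrite ltNge; apply/negP => h; apply: Gw; apply: vG => /=.
  have -> : dot (score X (responses Y w) mu) (score X (responses Y w) mu)
     = n%:R^-1 * dot (M *m E w) (M *m E w).
    by rewrite /score /M -scalemxAl !dotZl !dotZr -qq; ring.
  rewrite [leRHS](_ : _ = n%:R^-1 * (sigma ^+ 2 * complexity X delta)); last by ring.
  rewrite ler_pM2l ?invr_gt0//.
  by rewrite (le_trans h)// /quadratic_level MM.
have PGC : (P (~` G) <= (eps + expR (- delta))%:E)%E.
  apply: (@le_trans _ _ (P (~` typical `|` bad))).
    by apply: le_measure => //; rewrite inE; [exact: measurableC|exact: measurableU].
  by rewrite (le_trans (measureU2 _ _ _))// EFinD leeD.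
rewrite -[G]setCK probability_setC; last exact: measurableC.
have fG : P (~` G) \is a fin_num by rewrite fin_num_measure//; exact: measurableC.
by rewrite -(fineK fG) -EFinB lee_fin; move: PGC; rewrite -{1}(fineK fG) lee_fin; lra.
Qed.

End noise.

Section models.
Context {dO : measure_display} {O : measurableType dO} {R : realType}.
Context (P : probability O R) {n : nat}.
Context (Y : 'I_n -> {RV P >-> R}) (mu : 'cV[R]_n) (c : model R n).
Hypothesis n_gt0 : (0 < n)%N.
Hypothesis Y_mean : forall i, ('E_P[Y i] = (mu i 0)%:E)%E.
Hypothesis c_sd : sd_ge0 c.
Hypothesis Y_law : forall i (B : set R), measurable B ->
       distribution P (Y i) B = law c i (mu i 0) B.

Lemma coord_le_norm (u : 'cV[R]_n) i : u i 0 <= `|u|.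
Proof.
rewrite (le_trans (ler_norm _))// -[leRHS]/(mx_norm u) mx_normE.
by rewrite (@le_trans _ _ (`|u i 0|%:nng)%:num)// num_le; apply: (le_bigmax _ _ (i, 0)).
Qed.

Lemma typicalT (B : 'I_n -> set R) : (forall i, B i = setT) -> ~` typical Y B = set0.
Proof.
by move=> BT; apply/seteqP; split => // w /= []; move=> i _; rewrite /= BT.
Qed.

(** In the Gaussian and Bernoulli cases nothing is truncated.  A Poisson response
is truncated at its mean plus [(6 |mu| + 2) ln n]; the union bound over the
responses then costs [n * n^-2]. *)
Lemma responses_subgaussian delta : provisos c delta ->
  exists B : 'I_n -> set R, [/\ forall i, measurable (B i),
    forall i (a : R),
      (\int[P]_w (\1_(B i) (Y i w) * expR (a * (Y i w - mu i 0)))%:E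
       <= (expR (noise_level c mu ^+ 2 / 2 * a ^+ 2))%:E)%E
    & (P (~` typical Y B) <= (1 - expR (- delta) - confidence c delta)%:E)%E].
Proof.
move=> prov; set goal := exists B, _.
have untruncated :
    (forall i (a : R), (\int[P]_w (expR (a * (Y i w - mu i 0)))%:E
       <= (expR (noise_level c mu ^+ 2 / 2 * a ^+ 2))%:E)%E) ->
    confidence c delta = 1 - expR (- delta) -> goal.
  move=> mgf conf; exists (fun=> setT); split => // [i a|].
    rewrite (le_trans _ (mgf i a))// le_eqVlt; apply/orP; left; apply/eqP.
    by apply: eq_integral => w _; rewrite indicT mul1r.
  by rewrite typicalT// measure0 conf subrr.
rewrite {}/goal in untruncated *.
case: c c_sd Y_law untruncated prov => [s||] /= s0 YL untruncated prov.
- apply: untruncated => // i a; rewrite (gaussian_law_mgf (s := s i))//; last exact: YL.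
  rewrite lee_fin ler_expR ler_wpM2r ?sqr_ge0// ler_wpM2r ?invr_ge0//.
  have si : s i <= \big[Num.max/0]_(i < n) s i by exact: le_bigmax.
  by rewrite ler_pXn2r ?nnegrE// (le_trans (s0 i)).
- apply: untruncated => // i a; rewrite (le_trans (bernoulli_law_mgf _ _ (YL i)))//.
  by rewrite lee_fin ler_expR ler_wpM2r ?sqr_ge0//; lra.
have n3 := prov.2; set M := `|mu|; have M0 : 0 <= M by exact: normr_ge0.
have ln1 := @ln_ge1 R n n3; set l := ln n%:R in ln1 *.
(* as l >= 1, x - M >= 2 l, which makes each tail at most n^-2 *)
set x := (6 * M + 2) * l.
have rM0 : 0 <= Num.sqrt M by exact: sqrtr_ge0.
have Ml : M <= M * l by rewrite ler_peMr.
have x2 : 2 <= x by rewrite /x; lra.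
have xsig : x <= x + 3 * Num.sqrt M by lra.
have sig0 : 0 <= x + 3 * Num.sqrt M by lra.
have M9 : 9 * M <= (x + 3 * Num.sqrt M) ^+ 2.
  rewrite -[X in 9 * X](sqr_sqrtr M0); set r := Num.sqrt M in rM0 *; nra.
have mM i : mu i 0 <= M by exact: coord_le_norm.
have mB i : measurable [set y : R | y <= mu i 0 + x].
  rewrite (_ : [set y | _] = `]-oo, (mu i 0 + x)]%classic); first exact: measurable_itv.
  by apply/seteqP; split => y /=; rewrite in_itv.
exists (fun i => [set y | y <= mu i 0 + x]); split => // [i a|].
  exact: (poisson_truncated_mgf (Y_mean i) (YL i) (mM i)).
have -> : 1 - expR (- delta) - (1 - expR (- delta) - n%:R^-1) = n%:R^-1 by lra.
have mC i : measurable (Y i @^-1` ~` [set y | y <= mu i 0 + x]).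
  by apply: measurable_preimage_response; exact: measurableC.
have tail i : (P (Y i @^-1` ~` [set y | (y <= mu i 0 + x)%R]) <= (n%:R ^- 2)%:E)%E.
  rewrite (le_trans (poisson_upper_tail (Y_mean i) (YL i) x))// lee_fin.
  have -> : n%:R ^- 2 = expR (- (2 * l)) :> R.
    by rewrite expRN expRM_natl lnK// posrE ltr0n.
  by rewrite ler_expR; have := mM i; rewrite /x; lra.
apply: (@le_trans _ _ (\sum_(i \in [set: 'I_n])
   P (Y i @^-1` ~` [set y | (y <= mu i 0 + x)%R]))%E).
  have mT : measurable (~` typical Y (fun i => [set y | (y <= mu i 0 + x)%R])).
    by apply: measurableC; exact: measurable_typical.
  apply: content_sub_fsum => //; first exact: finite_finset.
  move=> w nt; apply: contrapT => nw; apply: nt => i _ /=.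
  by apply: contrapT => yi; apply: nw; exists i.
have -> : (\sum_(i \in [set: 'I_n]) P (Y i @^-1` ~` [set y | (y <= mu i 0 + x)%R])
   = \sum_i P (Y i @^-1` ~` [set y | (y <= mu i 0 + x)%R]))%E.
  rewrite [RHS]fsbig_seq ?index_enum_uniq//; apply: eq_fsbigl.
  by apply/seteqP; split => i //= _; exact: mem_index_enum.
rewrite (le_trans (lee_sum _ (fun i _ => tail i)))// sumEFin lee_fin.
by rewrite sumr_const card_ord -[(_ ^- 2) *+ _]mulr_natl expr2 invfM mulrA divff ?mul1r// pnatr_eq0 -lt0n.
Qed.

End models.

Theorem theorem4 (R : realType) (n d : nat) (X : 'M[R]_(n, d))
    (dO : measure_display) (O : measurableType dO) (P : probability O R)
    (Y : 'I_n -> {RV P >-> R}) (mu : 'cV[R]_n) (c : model R n)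
    (n_gt0 : (0 < n)%N)
    (Y_indep : mutually_independent Y)
    (Y_mean : forall i, 'E_P[Y i]%E = (mu i 0)%:E)
    (c_sd : sd_ge0 c)
    (Y_law : forall i (B : set R), measurable B ->
       distribution P (Y i) B = law c i (mu i 0) B) :
  (forall b : R, 0 < b -> forall w : O,
     L_smooth (smooth_domain c b) (objective X c (responses Y w))
       (smooth_const X c b))
  /\
  (forall delta b eta : R, 0 < delta -> 0 < b ->
     0 < eta <= 1 / smooth_const X c b ->
     0 < lambda_star X c mu delta b ->
     provisos c delta ->
     let excess_risk (T : nat) (w : O) :=
       risk X c Y (gd X c b eta (responses Y w) T)
       - min_over (ball2 b) (risk X c Y) in
     (forall T : nat, T%:R = T_star X c mu delta b eta ->
        ((confidence c delta)%:E <=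
         P [set w | (excess_risk T w <= risk_bound X c mu delta b)%R])%E)
     /\
     (T_star X c mu delta b eta \isn't a Num.int ->
      forall T : nat, T%:Z = Num.ceil (T_star X c mu delta b eta) ->
        ((confidence c delta)%:E <=
         P [set w | (excess_risk T w <=
                     risk_bound X c mu delta b
                     + rounding_term X c mu delta eta)%R])%E)).
Proof.
split=> [b b0 w|delta b eta d0 b0 eta1 l0 prov excess].
  exact: objective_smooth.
have n0 : 0 < n%:R :> R by rewrite ltr0n.
have eta0 : 0 < eta by case/andP: eta1.
set lambda := lambda_star X c mu delta b in l0.
pose C := complexity X delta; pose sigma := noise_level c mu.
have bn0 : 0 < b * Num.sqrt n%:R by rewrite mulr_gt0// sqrtr_gt0.
have lE : lambda = sigma / (b * Num.sqrt n%:R) * Num.sqrt C by [].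
have sC0 : 0 < Num.sqrt C.
  rewrite lt_neqAle sqrtr_ge0 andbT eq_sym; apply: contraTneq l0 => h.
  by rewrite lE h mulr0 ltxx.
have C0 : 0 < C by rewrite -sqrtr_gt0.
have s0 : 0 < sigma.
  by move: l0; rewrite lE pmulr_lgt0// pmulr_lgt0 ?invr_gt0.
have kE : (b * lambda) ^+ 2 = sigma ^+ 2 / n%:R * C.
  rewrite lE -[in RHS](sqr_sqrtr (ltW n0)) -[in RHS](sqr_sqrtr (ltW C0)).
  by field; rewrite !gt_eqF ?sqrtr_gt0.
have boundE : risk_bound X c mu delta b = b ^+ 2 * lambda.
  rewrite lE /risk_bound -/sigma -/C.
  by field; rewrite !gt_eqF ?sqrtr_gt0.
have roundE : rounding_term X c mu delta eta = eta / 2 * (b * lambda) ^+ 2.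
  rewrite kE /rounding_term -/sigma -/C.
  by field; rewrite gt_eqF.
have [B [mB mgf Ptail]] := responses_subgaussian n_gt0 Y_mean c_sd Y_law prov.
have RE : risk X c Y = objective X c mu := riskE X c Y_mean.
have prob T r : (forall w, let v := score X (responses Y w) mu in
      dot v v <= (b * lambda) ^+ 2 -> excess T w <= r) ->
    ((confidence c delta)%:E <= P [set w | (excess T w <= r)%R])%E.
  move=> h.
  have mG : measurable [set w | (excess T w <= r)%R].
    rewrite -[X in measurable X]setTI; apply: measurable_fun_ler => //.
    rewrite /excess RE; apply: measurable_funB => //.
    apply: measurable_objective; apply: measurable_gd => //.
    exact: measurable_responses.
  have := noise_bound n_gt0 Y_indep mB s0 mgf d0 C0 mG Ptail.
  rewrite opprB addrCA subrr addr0; apply => w v; rewrite -kE; exact: h.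
have rate T w e : 0 <= e -> lambda^-1 <= eta * T%:R <= lambda^-1 + e ->
    dot (score X (responses Y w) mu) (score X (responses Y w) mu) <= (b * lambda) ^+ 2 ->
    excess T w <= b ^+ 2 * lambda + e / 2 * (b * lambda) ^+ 2.
  move=> e0 tau vk; apply: (balanced_rate b0 l0 e0 tau).
  rewrite /excess RE /min_over mulrA; apply: gd_excess => //.
  exact: argmin_ball2.
have TE : eta * T_star X c mu delta b eta = lambda^-1.
  by rewrite /T_star -/lambda invfM mulrA divff ?mul1r// gt_eqF.
split=> [T TT|_ T TT]; apply: prob => w v vk.
- have -> : risk_bound X c mu delta b = b ^+ 2 * lambda + 0 / 2 * (b * lambda) ^+ 2.
    by rewrite boundE; ring.
  by apply: rate => //; rewrite TT TE addr0 lexx.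
- rewrite boundE roundE; apply: rate => //; first exact: ltW.
  have TR : T%:R = (Num.ceil (T_star X c mu delta b eta))%:~R :> R by rewrite -TT.
  rewrite TR -TE -[X in _ + X]mulr1 -mulrDr !ler_pM2l//.
  have /andP[lt ge] := ceil_itv (T_star X c mu delta b eta); rewrite ge/=.
  by rewrite -lerBlDr ltW//; move: lt; rewrite intrB.
Qed.
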